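(* Let $H$ be a Hopf algebra with invertible antipode and let $B$ be a braided-commutative algebra in the category of right Drinfeld–Yetter modules over $H$. Then $\mathcal B^R(B\#H^{op})\simeq Z^1_\triangleleft(H,B)\simeq(\mathcal B(B\#H^{op}))^{op}$ as groups.
   Context: Everything is over a field $k$; algebras are unital. A right Drinfeld–Yetter module over $H$ is a vector space $B$ with a right $H$-action $\triangleleft$ and a right $H$-coaction $b\mapsto b_{(0)}\otimes b_{(1)}$ such that $(b\triangleleft h_{(2)})_{(0)}\otimes h_{(1)}(b\triangleleft h_{(2)})_{(1)}=b_{(0)}\triangleleft h_{(1)}\otimes b_{(1)}h_{(2)}$. A braided-commutative algebra in this category is such a $B$ that is an algebra which is both a right $H$-module algebra and a right $H$-comodule algebra (with $(ab)_{(0)}\otimes(ab)_{(1)}=a_{(0)}b_{(0)}\otimes a_{(1)}b_{(1)}$), and such that $ab=b_{(0)}(a\triangleleft b_{(1)})$ for all $a,b\in B$. The action Hopf algebroid $B\#H^{op}$ is the vector space $B\otimes H$ with product $(a\#h)(b\#g)=a(b\triangleleft h_{(1)})\#gh_{(2)}$, source $s(a)=a\#1$, target $t(a)=a_{(0)}\#a_{(1)}$, $B$-bimodule structure $b.X.c=s(b)t(c)X$, coproduct $\Delta(a\#h)=(a\#h_{(1)})\otimes_B(1\#h_{(2)})$ and counit $\varepsilon(a\#h)=a\varepsilon(h)$. It is a left bialgebroid over $B$ (and a left and anti-left Hopf algebroid); write $\Delta X=X_{(1)}\otimes_BX_{(2)}$. A left bisection on a left bialgebroid $\mathcal L$ over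 $B$ is a unital linear map $\sigma:\mathcal L\to B$ such that (1) $\sigma(t(b)X)=\sigma(X)b$; (2) $\phi:=\sigma\circ s\in\mathrm{Aut}(B)$ (algebra automorphisms); (3) $\sigma(XY)=\sigma(Xt(\sigma(Y)))=\sigma(Xs(\phi^{-1}(\sigma(Y))))$ for all $b,X,Y$. $\mathcal B(\mathcal L)$ is the set of these with product $(\sigma\ast\eta)(X)=\sigma(s(\eta(X_{(1)}))X_{(2)})$ and identity $\varepsilon$ (a group for a left Hopf algebroid). A right bisection is a unital linear map $\sigma:\mathcal L\to B$ such that (1) $\sigma(s(b)X)=b\sigma(X)$; (2) $\psi:=\sigma\circ t\in\mathrm{Aut}(B)$; (3) $\sigma(XY)=\sigma(Xs(\sigma(Y)))=\sigma(Xt(\psi^{-1}(\sigma(Y))))$. $\mathcal B^R(\mathcal L)$ is the set of these with product $(\sigma\bullet\eta)(X)=\sigma(t(\eta(X_{(2)}))X_{(1)})$ and identity $\varepsilon$ (a group for an anti-left Hopf algebroid). The superscript $op$ denotes the opposite group. $Z^1_\triangleleft(H,B)$ is the group of unital linear maps $\varrho:H\to B$ with $\varrho(gh)=(\varrho(g)\triangleleft h_{(1)})\varrho(h_{(2)})$ for all $g,h\in H$ and such that $\psi(b)=b_{(0)}\varrho(b_{(1)})$ is an invertible map $B\to B$, with product $(\varrho\bullet\varrho')(h)=\varrho(h_{(1)})\psi(\varrho'(h_{(2)}))$, $\psi$ being the map associated to $\varrho$. *)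

(* Defs.v *)
From HB Require Import structures.
From mathcomp Require Import all_boot all_order all_algebra.
From mathcomp Require Import boolp classical_sets functions.
Set Implicit Arguments. Unset Strict Implicit. Unset Printing Implicit Defensive.
Import GRing.Theory.
Local Open Scope ring_scope.

(* Unital associative k-algebras. Unlike [algType], this does not force
   1 != 0, so that the zero algebra is allowed. *)
HB.mixin Record isUnitalAlgebra (k : fieldType) A of GRing.Lmodule k A := {
  amul : A -> A -> A;
  aone : A;
  amulA : associative amul;
  amul1l : left_id aone amul;
  amul1r : right_id aone amul;
  amul_linl : forall y, linear (amul^~ y);
  amul_linr : forall x, linear (amul x) }.

#[short(type="kAlgType")]
HB.structure Definition UnitalAlgebra (k : fieldType) :=
  {A of GRing.Lmodule k A & isUnitalAlgebra k A}.

Arguments aone {k s}.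
Infix "**" := amul (at level 40, left associativity) : ring_scope.

Section Tensor.
Variables (k : fieldType) (U V : lmodType k) (I : Type).
Variables (r : I -> U -> U) (l : I -> V -> V).

(* Formal sums of pairs modulo the relations of a tensor product over k, and
   the balancing relation (r i u, v) = (u, l i v). The scalar c in [TensBal] is
   redundant when the r i are linear. *)
Inductive tens_eq : seq (U * V) -> seq (U * V) -> Prop :=
| TensRefl s : tens_eq s s
| TensSym s t : tens_eq s t -> tens_eq t s
| TensTrans s t w : tens_eq s t -> tens_eq t w -> tens_eq s w
| TensCat s1 s2 t1 t2 :
    tens_eq s1 t1 -> tens_eq s2 t2 -> tens_eq (s1 ++ s2) (t1 ++ t2)
| TensComm s t : tens_eq (s ++ t) (t ++ s)
| TensAddl u u' v : tens_eq [:: (u + u', v)] [:: (u, v); (u', v)]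
| TensAddr u v v' : tens_eq [:: (u, v + v')] [:: (u, v); (u, v')]
| TensScale (c : k) u v : tens_eq [:: (c *: u, v)] [:: (u, c *: v)]
| TensZero v : tens_eq [:: (0, v)] [::]
| TensBal i (c : k) u v : tens_eq [:: (c *: r i u, v)] [:: (c *: u, l i v)].

Definition tens_eqb s t : bool := `[< tens_eq s t >].

Fact tens_eqb_equiv : equiv_class_of tens_eqb.
Proof.
split=> [s|s t|s t w].
- exact/asboolP/TensRefl.
- by apply/asboolP/asboolP; apply: TensSym.
- by move=> /asboolP h1 /asboolP h2; apply/asboolP; apply: TensTrans h1 h2.
Qed.
Canonical tens_equiv := EquivRelPack tens_eqb_equiv.

Definition tens : Type := {eq_quot tens_eqb}%qT.
HB.instance Definition _ := Choice.on tens.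
HB.instance Definition _ := EqQuotient.on tens.

Definition pi_tens (s : seq (U * V)) : tens := (\pi_tens s)%qT.

Lemma pi_tensE s t : (pi_tens s = pi_tens t) <-> tens_eq s t.
Proof.
by split=> [/eqmodP/asboolP|h]; last by apply/eqmodP/asboolP.
Qed.

Lemma repr_pi s : tens_eq (repr (pi_tens s)) s.
Proof. by apply/pi_tensE; rewrite /pi_tens reprK. Qed.

Lemma pi_repr (x : tens) : pi_tens (repr x) = x.
Proof. by rewrite /pi_tens reprK. Qed.

Definition tens_scale_seq (c : k) (s : seq (U * V)) :=
  [seq (c *: p.1, p.2) | p <- s].

Lemma tens_scale_seq_eq c s t :
  tens_eq s t -> tens_eq (tens_scale_seq c s) (tens_scale_seq c t).
Proof.
elim=> {s t}; rewrite /tens_scale_seq.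
- by move=> s; apply: TensRefl.
- by move=> s t _ h; apply: TensSym.
- by move=> s t w _ h1 _ h2; apply: TensTrans h1 h2.
- by move=> *; rewrite !map_cat; apply: TensCat.
- by move=> *; rewrite !map_cat; apply: TensComm.
- by move=> u u' v /=; rewrite scalerDr; apply: TensAddl.
- by move=> u u' v /=; apply: TensAddr.
- by move=> d u v /=; rewrite scalerA mulrC -scalerA; exact: TensScale.
- by move=> v /=; rewrite scaler0; apply: TensZero.
- by move=> i d u v /=; rewrite !scalerA; apply: TensBal.
Qed.

Definition tens_add (x y : tens) := pi_tens (repr x ++ repr y).
Definition tens_scale c (x : tens) := pi_tens (tens_scale_seq c (repr x)).

Lemma tens_addE s t : tens_add (pi_tens s) (pi_tens t) = pi_tens (s ++ t).
Proof. by apply/pi_tensE/TensCat; apply: repr_pi. Qed.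

Lemma tens_scaleE c s :
  tens_scale c (pi_tens s) = pi_tens (tens_scale_seq c s).
Proof. by apply/pi_tensE/tens_scale_seq_eq/repr_pi. Qed.

Lemma tens_pi_ind (P : tens -> Prop) :
  (forall s, P (pi_tens s)) -> forall x, P x.
Proof. by move=> h x; rewrite -(pi_repr x). Qed.

Lemma tens_addA : associative tens_add.
Proof.
elim/tens_pi_ind=> s; elim/tens_pi_ind=> t; elim/tens_pi_ind=> w.
by rewrite !tens_addE catA.
Qed.

Lemma tens_addC : commutative tens_add.
Proof.
elim/tens_pi_ind=> s; elim/tens_pi_ind=> t.
by rewrite !tens_addE; apply/pi_tensE/TensComm.
Qed.

Lemma tens_add0 : left_id (pi_tens [::]) tens_add.
Proof. by elim/tens_pi_ind=> s; rewrite tens_addE. Qed.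

HB.instance Definition _ :=
  GRing.isNmodule.Build tens tens_addA tens_addC tens_add0.

Lemma pi_tens_cat s t : pi_tens (s ++ t) = pi_tens s + pi_tens t.
Proof. by rewrite -tens_addE. Qed.

Lemma tens_addN : left_inverse 0 (tens_scale (-1)) +%R.
Proof.
elim/tens_pi_ind=> s; rewrite tens_scaleE.
elim: s => [|[u v] s IH] /=; first by rewrite addr0.
rewrite -cat1s pi_tens_cat -(cat1s (u, v)) pi_tens_cat addrACA IH addr0.
rewrite -pi_tens_cat; apply/pi_tensE; apply: TensTrans (TensZero v).
by apply: TensSym; rewrite scaleN1r -{1}(addNr u); apply: TensAddl.
Qed.

HB.instance Definition _ := GRing.Nmodule_isZmodule.Build tens tens_addN.

Lemma tens_scaleA c d x : tens_scale c (tens_scale d x) = tens_scale (c * d) x.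
Proof.
elim/tens_pi_ind: x => s; rewrite !tens_scaleE /tens_scale_seq -map_comp.
by congr pi_tens; apply: eq_map => p /=; rewrite scalerA.
Qed.

Lemma tens_scale1 : left_id 1 tens_scale.
Proof.
elim/tens_pi_ind=> s; rewrite tens_scaleE; congr pi_tens.
by rewrite -[RHS]map_id; apply: eq_map => -[u v] /=; rewrite scale1r.
Qed.

Lemma tens_scaleDr : right_distributive tens_scale +%R.
Proof.
move=> c; elim/tens_pi_ind=> s; elim/tens_pi_ind=> t.
by rewrite -pi_tens_cat !tens_scaleE -pi_tens_cat /tens_scale_seq map_cat.
Qed.

Lemma tens_scaleDl x : {morph tens_scale^~ x : c d / c + d}.
Proof.
move=> c d; elim/tens_pi_ind: x => s; rewrite !tens_scaleE.
elim: s => [|[u v] s IH] /=; first by rewrite addr0.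
rewrite -[LHS]/(pi_tens ([:: _] ++ _)) pi_tens_cat IH.
rewrite -(cat1s (c *: u, v)) -(cat1s (d *: u, v)) !pi_tens_cat addrACA.
congr (_ + _); rewrite -pi_tens_cat scalerDl.
by apply/pi_tensE/TensAddl.
Qed.

HB.instance Definition _ :=
  GRing.Zmodule_isLmodule.Build k tens tens_scaleA tens_scale1 tens_scaleDr
    tens_scaleDl.

Definition tpure (u : U) (v : V) : tens := pi_tens [:: (u, v)].

(* [tlift f t] is the sum of the f u v over a representative of t; it does not
   depend on the representative when f is bilinear and balanced. It renders
   Sweedler notation: a formula f t_(1) t_(2) is written [tlift f t]. *)
Definition tlift (W : nmodType) (f : U -> V -> W) (t : tens) : W :=
  \sum_(p <- repr t) f p.1 p.2.

Definition bilin (W : lmodType k) (f : U -> V -> W) :=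
  (forall v, linear (f^~ v)) /\ (forall u, linear (f u)).

Definition balanced (W : Type) (f : U -> V -> W) :=
  forall i u v, f (r i u) v = f u (l i v).

Section Lift.
Variables (W : lmodType k) (f : U -> V -> W).
Hypotheses (fb : bilin f) (fB : balanced f).

Let fDl u u' v : f (u + u') v = f u v + f u' v.
Proof. by have := fb.1 v 1 u u'; rewrite !scale1r. Qed.
Let fDr u v v' : f u (v + v') = f u v + f u v'.
Proof. by have := fb.2 u 1 v v'; rewrite !scale1r. Qed.
Let f0l v : f 0 v = 0.
Proof. by apply: (addrI (f 0 v)); rewrite -fDl !addr0. Qed.
Let f0r u : f u 0 = 0.
Proof. by apply: (addrI (f u 0)); rewrite -fDr !addr0. Qed.
Let fZl c u v : f (c *: u) v = c *: f u v.
Proof. by have := fb.1 v c u 0; rewrite /= !addr0 f0l addr0. Qed.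
Let fZr c u v : f u (c *: v) = c *: f u v.
Proof. by have := fb.2 u c v 0; rewrite /= !addr0 f0r addr0. Qed.

Lemma tens_eq_sum s t : tens_eq s t ->
  \sum_(p <- s) f p.1 p.2 = \sum_(p <- t) f p.1 p.2.
Proof.
elim=> {s t} //=.
- by move=> s t w _ -> _ ->.
- by move=> s1 s2 t1 t2 _ h1 _ h2; rewrite !big_cat /= h1 h2.
- by move=> s t; rewrite !big_cat /= addrC.
- by move=> u u' v; rewrite !big_cons !big_nil /= !addr0 fDl.
- by move=> u v v'; rewrite !big_cons !big_nil /= !addr0 fDr.
- by move=> c u v; rewrite !big_cons !big_nil /= !addr0 fZl fZr.
- by move=> v; rewrite !big_cons !big_nil /= !addr0 f0l.
- by move=> i c u v; rewrite !big_cons !big_nil /= !addr0 !fZl fB.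
Qed.

Lemma tlift_pi s : tlift f (pi_tens s) = \sum_(p <- s) f p.1 p.2.
Proof. exact/tens_eq_sum/repr_pi. Qed.

Lemma tlift_pure u v : tlift f (tpure u v) = f u v.
Proof. by rewrite tlift_pi big_seq1. Qed.

Lemma tlift_linear : linear (tlift f).
Proof.
move=> c; elim/tens_pi_ind=> s; elim/tens_pi_ind=> t.
rewrite -[c *: pi_tens s]/(tens_scale c _) tens_scaleE -pi_tens_cat.
rewrite !tlift_pi big_cat /= big_map scaler_sumr; congr (_ + _).
by apply: eq_bigr => p _ /=; rewrite fZl.
Qed.

End Lift.

Lemma tpure_bilin : bilin tpure.
Proof.
split=> [v c u u'|u c v v']; rewrite /tpure.
  rewrite -[c *: pi_tens _]/(tens_scale c _) tens_scaleE -pi_tens_cat.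
  exact/pi_tensE/TensAddl.
rewrite -[c *: pi_tens _]/(tens_scale c _) tens_scaleE -pi_tens_cat.
apply/pi_tensE/(TensTrans (TensAddr _ _ _)).
rewrite -cat1s -[X in tens_eq _ X]cat1s; apply: TensCat; last exact: TensRefl.
exact/TensSym/TensScale.
Qed.

Lemma tpure_balanced : balanced tpure.
Proof.
move=> i u v; apply/pi_tensE.
by have := TensBal i 1 u v; rewrite !scale1r.
Qed.

Lemma tlift_comp (W W' : lmodType k) (f : U -> V -> W) (g : W -> W') t :
  linear g -> g (tlift f t) = tlift (fun u v => g (f u v)) t.
Proof.
move=> gl; pose G := GRing.isLinear.Build k W W' *:%R g gl.
pose g' : {linear W -> W'} := HB.pack g G.
by rewrite -[g]/(g' : _ -> _) /tlift raddf_sum.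
Qed.

Lemma tens_sum t : t = tlift tpure t.
Proof.
rewrite -{1}(pi_repr t) /tlift; elim: (repr t) => [|[u v] s IH].
  by rewrite big_nil.
by rewrite -cat1s pi_tens_cat big_cons IH.
Qed.

Lemma tens_ext (W : lmodType k) (f g : tens -> W) :
  linear f -> linear g -> (forall u v, f (tpure u v) = g (tpure u v)) -> f =1 g.
Proof.
move=> fl gl h t; rewrite (tens_sum t) !tlift_comp //.
by apply: eq_bigr => p _; apply: h.
Qed.

Lemma eq_tlift (W : nmodType) (f g : U -> V -> W) t :
  (forall u v, f u v = g u v) -> tlift f t = tlift g t.
Proof. by move=> h; apply: eq_bigr. Qed.

End Tensor.

Arguments tpure {k U V I r l}.

Notation tensor U V :=
  (tens (fun (_ : void) (u : U) => u) (fun (_ : void) (v : V) => v)).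
Infix "⊗" := tpure (at level 45, left associativity) : ring_scope.
Notation "'\sw_' ( x , y <- t ) E" := (tlift (fun x y => E) t)
  (at level 41, E at level 41, t at level 200, x name, y name,
   format "'\sw_' ( x ,  y  <-  t )  E") : ring_scope.

Section Linearity.
Variable k : fieldType.
Implicit Types (X Y : lmodType k) (A : kAlgType k).

Lemma lin_comp X Y (Z : lmodType k) (g : Y -> Z) (f : X -> Y) :
  linear g -> linear f -> linear (fun x => g (f x)).
Proof. by move=> hg hf c x y; rewrite hf hg. Qed.

Lemma lin0 X Y (f : X -> Y) : linear f -> f 0 = 0.
Proof. by move=> /(_ (-1) 0 0); rewrite scaler0 addr0 scaleN1r addNr. Qed.

Lemma linZ X Y (f : X -> Y) c x : linear f -> f (c *: x) = c *: f x.
Proof. by move=> hf; have := hf c x 0; rewrite (lin0 hf) !addr0. Qed.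

Lemma lin_mull X A (f : X -> A) a : linear f -> linear (fun x => f x ** a).
Proof. exact: (lin_comp (amul_linl a)). Qed.

Lemma lin_mulr X A (f : X -> A) a : linear f -> linear (fun x => a ** f x).
Proof. exact: (lin_comp (amul_linr a)). Qed.

Lemma lin_scaler X Y (f : X -> Y) (c : k) :
  linear f -> linear (fun x => c *: f x).
Proof.
by move=> hf d x y; rewrite hf scalerDr !scalerA mulrC.
Qed.

Lemma lin_scalel X Y (f : X -> k) (v : Y) :
  scalar f -> linear (fun x => f x *: v).
Proof. by move=> hf d x y; rewrite hf scalerDl scalerA. Qed.

Variables (U V : lmodType k) (I : Type) (r : I -> U -> U) (l : I -> V -> V).

Lemma lin_purel X (f : X -> U) v :
  linear f -> linear (fun x => f x ⊗ v : tens r l).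
Proof. exact: (lin_comp ((tpure_bilin r l).1 v)). Qed.

Lemma lin_purer X (f : X -> V) u :
  linear f -> linear (fun x => u ⊗ f x : tens r l).
Proof. exact: (lin_comp ((tpure_bilin r l).2 u)). Qed.

Lemma lin_tliftr X Y (f : U -> V -> Y) (g : X -> tens r l) :
  bilin f -> balanced r l f -> linear g -> linear (fun x => tlift f (g x)).
Proof. by move=> *; apply: lin_comp => //; apply: tlift_linear. Qed.

Lemma lin_tliftl X Y (f : X -> U -> V -> Y) (t : tens r l) :
  (forall u v, linear (fun x => f x u v)) -> linear (fun x => tlift (f x) t).
Proof.
move=> hf c x y; rewrite /tlift scaler_sumr -big_split /=.
by apply: eq_bigr => p _; apply: hf.
Qed.

End Linearity.

Lemma tensor_balanced (k : fieldType) (U V : lmodType k) (W : Type)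
  (f : U -> V -> W) :
  balanced (fun (_ : void) (u : U) => u) (fun (_ : void) (v : V) => v) f.
Proof. by case. Qed.

Record hopfAlgebra (k : fieldType) := HopfAlgebra {
  hopf_alg :> kAlgType k;
  comul : hopf_alg -> tensor hopf_alg hopf_alg;
  counit : hopf_alg -> k;
  antipode : hopf_alg -> hopf_alg;
  comul_linear : linear comul;
  counit_scalar : scalar counit;
  antipode_linear : linear antipode;
  comul_coassoc : forall h,
    \sw_(h1, h2 <- comul h) \sw_(h11, h12 <- comul h1)
      (h11 ⊗ (h12 ⊗ h2) : tensor hopf_alg (tensor hopf_alg hopf_alg))
    = \sw_(h1, h2 <- comul h) (h1 ⊗ comul h2);
  comul_counitl : forall h, \sw_(h1, h2 <- comul h) (counit h1 *: h2) = h;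
  comul_counitr : forall h, \sw_(h1, h2 <- comul h) (counit h2 *: h1) = h;
  comul_mul : forall g h,
    comul (g ** h) = \sw_(g1, g2 <- comul g) \sw_(h1, h2 <- comul h)
      ((g1 ** h1) ⊗ (g2 ** h2));
  comul_one : comul aone = aone ⊗ aone;
  counit_mul : forall g h, counit (g ** h) = counit g * counit h;
  counit_one : counit aone = 1;
  antipodel : forall h,
    \sw_(h1, h2 <- comul h) (antipode h1 ** h2) = counit h *: aone;
  antipoder : forall h,
    \sw_(h1, h2 <- comul h) (h1 ** antipode h2) = counit h *: aone }.

Record is_right_module (k : fieldType) (H : hopfAlgebra k) (B : lmodType k)
    (act : B -> H -> B) : Prop := IsRightModule {
  act_linl : forall h, linear (act^~ h);
  act_linr : forall b, linear (act b);
  act_one : forall b, act b aone = b;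
  act_mul : forall b g h, act b (g ** h) = act (act b g) h }.

Record is_right_comodule (k : fieldType) (H : hopfAlgebra k) (B : lmodType k)
    (coact : B -> tensor B H) : Prop := IsRightComodule {
  coact_linear : linear coact;
  coact_coassoc : forall b,
    \sw_(b0, b1 <- coact b) \sw_(b00, b01 <- coact b0)
      (b00 ⊗ (b01 ⊗ b1) : tensor B (tensor H H))
    = \sw_(b0, b1 <- coact b) (b0 ⊗ comul b1);
  coact_counit : forall b, \sw_(b0, b1 <- coact b) (counit b1 *: b0) = b }.

Record is_DY_module (k : fieldType) (H : hopfAlgebra k) (B : lmodType k)
    (act : B -> H -> B) (coact : B -> tensor B H) : Prop := IsDYModule {
  DY_module : is_right_module act;
  DY_comodule : is_right_comodule coact;
  DY_compat : forall b h,
    \sw_(h1, h2 <- comul h) \sw_(c0, c1 <- coact (act b h2))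
      (c0 ⊗ (h1 ** c1) : tensor B H)
    = \sw_(b0, b1 <- coact b) \sw_(h1, h2 <- comul h)
      (act b0 h1 ⊗ (b1 ** h2)) }.

Record is_module_algebra (k : fieldType) (H : hopfAlgebra k) (B : kAlgType k)
    (act : B -> H -> B) : Prop := IsModuleAlgebra {
  act_algM : forall a b h,
    act (a ** b) h = \sw_(h1, h2 <- comul h) (act a h1 ** act b h2);
  act_alg1 : forall h, act aone h = counit h *: aone }.

Record is_comodule_algebra (k : fieldType) (H : hopfAlgebra k) (B : kAlgType k)
    (coact : B -> tensor B H) : Prop := IsComoduleAlgebra {
  coact_algM : forall a b,
    coact (a ** b) = \sw_(a0, a1 <- coact a) \sw_(b0, b1 <- coact b)
      ((a0 ** b0) ⊗ (a1 ** b1));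
  coact_alg1 : coact aone = aone ⊗ aone }.

Record braidedCommAlgebra (k : fieldType) (H : hopfAlgebra k) :=
  BraidedCommAlgebra {
  bc_alg :> kAlgType k;
  act : bc_alg -> H -> bc_alg;
  coact : bc_alg -> tensor bc_alg H;
  bc_DY : is_DY_module act coact;
  bc_module_algebra : is_module_algebra act;
  bc_comodule_algebra : is_comodule_algebra coact;
  bc_comm : forall a b : bc_alg,
    a ** b = \sw_(b0, b1 <- coact b) (b0 ** act a b1) }.

(* Tensor product over B of the B-bimodules b.X.c = s(b) t(c) X. *)
Notation tensB s t :=
  (tens (fun b X => t b ** X) (fun b X => s b ** X)).

(* The same with second factor the left B-module tensB s t. *)
Notation tensB3 s t :=
  (tens (fun b X => t b ** X)
     (fun b (Z : tensB s t) => \sw_(X, Y <- Z) ((s b ** X) ⊗ Y : tensB s t))).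

(* In [bd_comul_mul] the expression X_(1) Y_(1) ⊗ X_(2) Y_(2) is balanced in X
   for fixed Y_(1), Y_(2), and then in Y by [bd_takeuchi], hence the order of
   the two sums. *)
Record leftBialgebroid (k : fieldType) (B : kAlgType k) := LeftBialgebroid {
  bd_tot :> kAlgType k;
  src : B -> bd_tot;
  tgt : B -> bd_tot;
  bd_comul : bd_tot -> tensB src tgt;
  bd_counit : bd_tot -> B;
  src_linear : linear src;
  src_mul : forall a b, src (a ** b) = src a ** src b;
  src_one : src aone = aone;
  tgt_linear : linear tgt;
  tgt_mul : forall a b, tgt (a ** b) = tgt b ** tgt a;
  tgt_one : tgt aone = aone;
  src_tgt : forall a b, src a ** tgt b = tgt b ** src a;
  bd_comul_linear : linear bd_comul;
  bd_comul_bimod : forall b c X,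
    bd_comul (src b ** tgt c ** X) =
      \sw_(X1, X2 <- bd_comul X) ((src b ** X1) ⊗ (tgt c ** X2));
  bd_counit_linear : linear bd_counit;
  bd_counit_bimod : forall b c X,
    bd_counit (src b ** tgt c ** X) = b ** bd_counit X ** c;
  bd_coassoc : forall X,
    \sw_(X1, X2 <- bd_comul X) \sw_(X11, X12 <- bd_comul X1)
      (X11 ⊗ (X12 ⊗ X2) : tensB3 src tgt)
    = \sw_(X1, X2 <- bd_comul X) (X1 ⊗ bd_comul X2);
  bd_counitl : forall X,
    \sw_(X1, X2 <- bd_comul X) (src (bd_counit X1) ** X2) = X;
  bd_counitr : forall X,
    \sw_(X1, X2 <- bd_comul X) (tgt (bd_counit X2) ** X1) = X;
  bd_takeuchi : forall X b,
    \sw_(X1, X2 <- bd_comul X) ((X1 ** tgt b) ⊗ X2 : tensB src tgt)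
    = \sw_(X1, X2 <- bd_comul X) (X1 ⊗ (X2 ** src b));
  bd_comul_mul : forall X Y,
    bd_comul (X ** Y) = \sw_(Y1, Y2 <- bd_comul Y) \sw_(X1, X2 <- bd_comul X)
      ((X1 ** Y1) ⊗ (X2 ** Y2));
  bd_comul_one : bd_comul aone = aone ⊗ aone;
  bd_counit_src : forall X Y,
    bd_counit (X ** Y) = bd_counit (X ** src (bd_counit Y));
  bd_counit_tgt : forall X Y,
    bd_counit (X ** Y) = bd_counit (X ** tgt (bd_counit Y));
  bd_counit_one : bd_counit aone = aone }.

Lemma tlift_exchange (k : fieldType) (U V U' V' : lmodType k) (I J : Type)
    (r : I -> U -> U) (l : I -> V -> V) (r' : J -> U' -> U') (l' : J -> V' -> V')
    (W : nmodType) (F : U -> V -> U' -> V' -> W) (s : tens r l)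
    (t : tens r' l') :
  \sw_(x, y <- s) \sw_(z, w <- t) F x y z w =
  \sw_(z, w <- t) \sw_(x, y <- s) F x y z w.
Proof. exact: exchange_big. Qed.

Lemma tlift_tlift (k : fieldType) (U V U' V' W : lmodType k) (I J : Type)
    (r : I -> U -> U) (l : I -> V -> V) (r' : J -> U' -> U') (l' : J -> V' -> V')
    (f : U -> V -> W) (g : U' -> V' -> tens r l) (t : tens r' l') :
  bilin f -> balanced r l f ->
  tlift f (tlift g t) = \sw_(x, y <- t) tlift f (g x y).
Proof. by move=> *; apply: tlift_comp; apply: tlift_linear. Qed.

Lemma tlift_tpure (k : fieldType) (U V U' V' W : lmodType k) (I J : Type)
    (r : I -> U -> U) (l : I -> V -> V) (r' : J -> U' -> U') (l' : J -> V' -> V')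
    (f : U -> V -> W) (g : U' -> V' -> U) (g' : U' -> V' -> V)
    (t : tens r' l') :
  bilin f -> balanced r l f ->
  tlift f (\sw_(x, y <- t) (g x y ⊗ g' x y : tens r l)) =
  \sw_(x, y <- t) f (g x y) (g' x y).
Proof.
move=> fb fB; rewrite tlift_tlift //; apply: eq_tlift => x y.
exact: tlift_pure.
Qed.

Section DYLinearity.
Variables (k : fieldType) (H : hopfAlgebra k) (B : braidedCommAlgebra H).
Implicit Type X : lmodType k.

Lemma lin_counit X (Y : lmodType k) (f : X -> H) (v : Y) :
  linear f -> linear (fun x => counit (f x) *: v).
Proof.
by move=> hf; apply: lin_scalel => c x y; rewrite hf counit_scalar.
Qed.

Lemma lin_actl X (f : X -> B) (h : H) :
  linear f -> linear (fun x => act (f x) h).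
Proof. exact: (lin_comp (act_linl (DY_module (bc_DY B)) h)). Qed.

Lemma lin_actr X (f : X -> H) (b : B) :
  linear f -> linear (fun x => act b (f x)).
Proof. exact: (lin_comp (act_linr (DY_module (bc_DY B)) b)). Qed.

Lemma lin_coact X (f : X -> B) :
  linear f -> linear (fun x => coact (f x)).
Proof. exact: (lin_comp (coact_linear (DY_comodule (bc_DY B)))). Qed.

Lemma lin_comul X (f : X -> H) :
  linear f -> linear (fun x => comul (f x)).
Proof. exact: (lin_comp (@comul_linear _ H)). Qed.

Lemma lin_id X : linear (fun x : X => x).
Proof. by []. Qed.
End DYLinearity.

(* Proves linearity of an expression in one of its variables. *)
Ltac lin :=
  cbv beta;
  lazymatch goal with
  | |- bilin _ => split=> ?; lin
  | |- @balanced _ _ _ _ _ _ _ _ => try exact: tensor_balanced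
  | |- @GRing.linear_for _ _ _ _ (fun x => x) => exact: lin_id
  | |- @GRing.linear_for _ _ _ _ (fun x => tlift (@?F x) (@?T x)) =>
      lazymatch T with
      | (fun _ => ?c) => apply: lin_tliftl => ? ?; lin
      | _ => apply: lin_tliftr; lin
      end
  | |- @GRing.linear_for _ _ _ _ (fun x => (@?F x) ** (@?T x)) =>
      lazymatch T with
      | (fun _ => ?c) => apply: lin_mull; lin
      | _ => apply: lin_mulr; lin
      end
  | |- @GRing.linear_for _ _ _ _ (fun x => (@?F x) ⊗ (@?T x)) =>
      lazymatch T with
      | (fun _ => ?c) => apply: lin_purel; lin
      | _ => apply: lin_purer; lin
      end
  | |- @GRing.linear_for _ _ _ _ (fun x => act (@?F x) (@?T x)) =>
      lazymatch T with
      | (fun _ => ?c) => apply: lin_actl; lin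
      | _ => apply: lin_actr; lin
      end
  | |- @GRing.linear_for _ _ _ _ (fun x => coact (@?T x)) =>
      apply: lin_coact; lin
  | |- @GRing.linear_for _ _ _ _ (fun x => comul (@?T x)) =>
      apply: lin_comul; lin
  | |- @GRing.linear_for _ _ _ _ (fun x => counit (@?F x) *: (@?T x)) =>
      lazymatch T with
      | (fun _ => ?c) => apply: lin_counit; lin
      | _ => apply: lin_scaler; lin
      end
  | |- @GRing.linear_for _ _ _ _ (amul _) => exact: amul_linr
  | |- @GRing.linear_for _ _ _ _ (act _) => apply: lin_actr; exact: lin_id
  | |- @GRing.linear_for _ _ _ _ (tpure _) => apply: lin_purer; exact: lin_id
  | |- @GRing.linear_for _ _ _ _ comul => exact: comul_linear
  | |- @GRing.linear_for _ _ _ _ coact => apply: lin_coact; exact: lin_id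
  | |- @GRing.linear_for _ _ _ _ (tlift _) => apply: tlift_linear; lin
  | |- _ => first [ exact: comul_linear | match goal with h : forall _, _ |- _ => exact: h end | idtac ]
  end.

Section Smash.
Variables (k : fieldType) (H : hopfAlgebra k) (B : braidedCommAlgebra H).

Definition smash : Type := tensor B H.
HB.instance Definition _ := GRing.Lmodule.on smash.

Definition smash_mul (X Y : smash) : smash :=
  \sw_(a, h <- X) \sw_(b, g <- Y) \sw_(h1, h2 <- comul h)
    ((a ** act b h1) ⊗ (g ** h2)).

Lemma smash_mul_linl Y : linear (smash_mul^~ Y).
Proof. rewrite /smash_mul. lin. Qed.

Lemma smash_mul_linr X : linear (smash_mul X).
Proof. rewrite /smash_mul. lin. Qed.

Lemma smash_mul_pure a h b g :
  smash_mul (a ⊗ h) (b ⊗ g) =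
  \sw_(h1, h2 <- comul h) ((a ** act b h1) ⊗ (g ** h2)).
Proof.
rewrite /smash_mul tlift_pure; [|lin|lin].
by rewrite tlift_pure; [|lin|lin].
Qed.

Lemma comul3 (W : lmodType k) (F : H -> H -> H -> W) h :
    (forall y z, linear (fun x => F x y z)) ->
    (forall x z, linear (fun y => F x y z)) ->
    (forall x y, linear (fun z => F x y z)) ->
  \sw_(x, y <- comul h) \sw_(x1, x2 <- comul x) F x1 x2 y =
  \sw_(x, y <- comul h) \sw_(y1, y2 <- comul y) F x y1 y2.
Proof.
move=> F1 F2 F3.
have /(congr1 (fun t => \sw_(x, s <- t) \sw_(y, z <- s) F x y z)) :=
  comul_coassoc h.
pose G (x : H) (s : tensor H H) : W := \sw_(y, z <- s) F x y z.
have G1 : bilin G by split=> ?; rewrite /G; lin.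
rewrite !(tlift_tlift (f := G)) //; try lin.
have e1 x y z : G x (y ⊗ z) = F x y z.
  by rewrite /G tlift_pure //; lin.
move=> e; transitivity (\sw_(h1, h2 <- comul h) \sw_(h11, h12 <- comul h1)
  tlift G (h11 ⊗ (h12 ⊗ h2) : tensor H (tensor H H))).
  apply: eq_tlift => x y; apply: eq_tlift => x1 x2.
  by rewrite tlift_pure ?e1 //; lin.
transitivity (\sw_(h1, h2 <- comul h)
  tlift G (h1 ⊗ comul h2 : tensor H (tensor H H))).
  by rewrite -e; apply: eq_tlift => x y; rewrite tlift_tlift //; lin.
by apply: eq_tlift => x y; rewrite tlift_pure //; lin.
Qed.

Lemma mul_tlift (U V : lmodType k) I (r : I -> U -> U) (l : I -> V -> V)
    (A : kAlgType k) (a : A) (f : U -> V -> A) (t : tens r l) :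
  a ** tlift f t = \sw_(x, y <- t) (a ** f x y).
Proof. exact: (tlift_comp _ _ (amul_linr a)). Qed.

Lemma tlift_mul (U V : lmodType k) I (r : I -> U -> U) (l : I -> V -> V)
    (A : kAlgType k) (a : A) (f : U -> V -> A) (t : tens r l) :
  tlift f t ** a = \sw_(x, y <- t) (f x y ** a).
Proof. exact: (tlift_comp _ _ (amul_linl a)). Qed.

Lemma smash_mulA : associative smash_mul.
Proof.
move=> X Y Z.
move: X; apply: tens_ext => [||a h].
- by move=> c x y; rewrite smash_mul_linl.
- by move=> c x y; rewrite !smash_mul_linl.
move: Y; apply: tens_ext => [||b g].
- by move=> c x y; rewrite smash_mul_linl smash_mul_linr.
- by move=> c x y; rewrite smash_mul_linr smash_mul_linl.
move: Z; apply: tens_ext => [||c f].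
- by move=> d x y; rewrite !smash_mul_linr.
- by move=> d x y; rewrite smash_mul_linr.
transitivity (\sw_(g1, g2 <- comul g) \sw_(x, y <- comul h)
    \sw_(x1, x2 <- comul x)
    ((a ** (act b x1 ** act c (g1 ** x2))) ⊗ (f ** g2 ** y) : smash)).
  rewrite smash_mul_pure.
  rewrite (tlift_comp _ _ (smash_mul_linr (a ⊗ h))).
  apply: eq_tlift => g1 g2; rewrite smash_mul_pure.
  apply: eq_tlift => x y.
  rewrite (act_algM (bc_module_algebra B)) mul_tlift.
  have pl : linear (fun z => z ⊗ (f ** g2 ** y) : smash) by lin.
  rewrite (tlift_comp _ _ pl); apply: eq_tlift => x1 x2.
  by rewrite (act_mul (DY_module (bc_DY B))).
rewrite smash_mul_pure (tlift_comp _ _ (smash_mul_linl (c ⊗ f))).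
transitivity (\sw_(g1, g2 <- comul g) \sw_(x, y <- comul h)
    \sw_(x1, x2 <- comul y)
    ((a ** (act b x ** act c (g1 ** x1))) ⊗ (f ** g2 ** x2) : smash)).
  by apply: eq_tlift => g1 g2; apply: comul3; move=> *; lin.
rewrite tlift_exchange; apply: eq_tlift => x y.
rewrite smash_mul_pure comul_mul tlift_tlift; [|lin|lin].
apply: eq_tlift => g1 g2; rewrite tlift_tpure; [|lin|lin].
by apply: eq_tlift => x1 x2; rewrite !amulA.
Qed.

Lemma comulE1 (W : lmodType k) (f : H -> H -> W) : bilin f ->
  tlift f (comul aone) = f aone aone.
Proof. by move=> fb; rewrite comul_one tlift_pure //; lin. Qed.

Lemma smash_mul1l : left_id (aone ⊗ aone) smash_mul.
Proof.
apply: tens_ext => [||b g]; [exact: smash_mul_linr|by []|].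
rewrite smash_mul_pure comulE1; last by lin.
by rewrite amul1l amul1r (act_one (DY_module (bc_DY B))).
Qed.

Lemma comul_counitl_lin (W : lmodType k) (f : H -> W) h : linear f ->
  \sw_(h1, h2 <- comul h) (counit h1 *: f h2) = f h.
Proof.
move=> hf; rewrite -[in RHS](comul_counitl h) tlift_comp //.
by apply: eq_tlift => x y; rewrite linZ.
Qed.

Lemma comul_counitr_lin (W : lmodType k) (f : H -> W) h : linear f ->
  \sw_(h1, h2 <- comul h) (counit h2 *: f h1) = f h.
Proof.
move=> hf; rewrite -[in RHS](comul_counitr h) tlift_comp //.
by apply: eq_tlift => x y; rewrite linZ.
Qed.

Lemma amulZr (A : kAlgType k) c (x y : A) : x ** (c *: y) = c *: (x ** y).
Proof. exact: linZ (amul_linr x). Qed.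

Lemma amulZl (A : kAlgType k) c (x y : A) : (c *: x) ** y = c *: (x ** y).
Proof. exact: linZ (amul_linl y). Qed.

Lemma tpureZl (U V : lmodType k) I (r : I -> U -> U) (l : I -> V -> V) c u v :
  (c *: u) ⊗ v = c *: (u ⊗ v) :> tens r l.
Proof. exact: linZ ((tpure_bilin r l).1 v). Qed.

Lemma tpureZr (U V : lmodType k) I (r : I -> U -> U) (l : I -> V -> V) c u v :
  u ⊗ (c *: v) = c *: (u ⊗ v) :> tens r l.
Proof. exact: linZ ((tpure_bilin r l).2 u). Qed.

Lemma smash_mul1r : right_id (aone ⊗ aone) smash_mul.
Proof.
apply: tens_ext => [||a h]; [exact: smash_mul_linl|by []|].
rewrite smash_mul_pure -(comul_counitl_lin (f := tpure a)); last by lin.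
apply: eq_tlift => x y.
by rewrite (act_alg1 (bc_module_algebra B)) amulZr amul1r amul1l tpureZl.
Qed.

HB.instance Definition _ := isUnitalAlgebra.Build k smash
  smash_mulA smash_mul1l smash_mul1r smash_mul_linl smash_mul_linr.

Lemma coact3 (W : lmodType k) (F : B -> H -> H -> W) b :
    (forall y z, linear (fun x => F x y z)) ->
    (forall x z, linear (fun y => F x y z)) ->
    (forall x y, linear (fun z => F x y z)) ->
  \sw_(x, y <- coact b) \sw_(x1, x2 <- coact x) F x1 x2 y =
  \sw_(x, y <- coact b) \sw_(y1, y2 <- comul y) F x y1 y2.
Proof.
move=> F1 F2 F3.
have /(congr1 (fun t => \sw_(x, s <- t) \sw_(y, z <- s) F x y z)) :=
  coact_coassoc (DY_comodule (bc_DY B)) b.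
pose G (x : B) (s : tensor H H) : W := \sw_(y, z <- s) F x y z.
have G1 : bilin G by split=> ?; rewrite /G; lin.
rewrite !(tlift_tlift (f := G)) //; try lin.
have e1 x y z : G x (y ⊗ z) = F x y z.
  by rewrite /G tlift_pure //; lin.
move=> e; transitivity (\sw_(x, y <- coact b) \sw_(x1, x2 <- coact x)
  tlift G (x1 ⊗ (x2 ⊗ y) : tensor B (tensor H H))).
  apply: eq_tlift => x y; apply: eq_tlift => x1 x2.
  by rewrite tlift_pure ?e1 //; lin.
transitivity (\sw_(x, y <- coact b)
  tlift G (x ⊗ comul y : tensor B (tensor H H))).
  by rewrite -e; apply: eq_tlift => x y; rewrite tlift_tlift //; lin.
by apply: eq_tlift => x y; rewrite tlift_pure //; lin.
Qed.

Lemma coact_counit_lin (W : lmodType k) (f : B -> W) b : linear f ->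
  \sw_(b0, b1 <- coact b) (counit b1 *: f b0) = f b.
Proof.
move=> hf; rewrite -[in RHS](coact_counit (DY_comodule (bc_DY B)) b).
by rewrite tlift_comp //; apply: eq_tlift => x y; rewrite linZ.
Qed.

Definition smash_src (a : B) : smash := a ⊗ aone.
Definition smash_tgt (a : B) : smash := coact a.

Lemma smash_pureE (a b : B) (h g : H) :
  (a ⊗ h : smash) ** (b ⊗ g : smash) =
  \sw_(h1, h2 <- comul h) ((a ** act b h1) ⊗ (g ** h2)).
Proof. exact: smash_mul_pure. Qed.

Lemma smash_srcE (b a : B) (h : H) :
  smash_src b ** (a ⊗ h : smash) = (b ** a) ⊗ h.
Proof.
rewrite smash_pureE comulE1; last by lin.
by rewrite amul1r (act_one (DY_module (bc_DY B))).
Qed.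

(* Braided commutativity turns t(b)(a#h) into a b_(0) # h b_(1). *)
Lemma smash_tgtE (b a : B) (h : H) :
  smash_tgt b ** (a ⊗ h : smash) =
  \sw_(b0, b1 <- coact b) ((a ** b0) ⊗ (h ** b1)).
Proof.
rewrite /smash_tgt {1}[coact b]tens_sum tlift_mul.
transitivity (\sw_(b0, b1 <- coact b) \sw_(x, y <- comul b1)
  ((b0 ** act a x) ⊗ (h ** y) : smash)).
  by apply: eq_tlift => b0 b1; rewrite smash_pureE.
rewrite -(coact3 (F := fun b x y => (b ** act a x) ⊗ (h ** y) : smash)).
- apply: eq_tlift => b0 b1; rewrite (bc_comm a b0).
  have hl : linear (fun z => z ⊗ (h ** b1) : smash) by lin.
  by rewrite (tlift_comp _ _ hl).
- by move=> *; lin.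
- by move=> *; lin.
- by move=> *; lin.
Qed.

Lemma smash_ext (W : lmodType k) (f g : smash -> W) :
  linear f -> linear g -> (forall (a : B) (h : H), f (a ⊗ h) = g (a ⊗ h)) ->
  f =1 g.
Proof. exact: tens_ext. Qed.

Lemma smash_src_linear : linear smash_src.
Proof. by rewrite /smash_src; lin. Qed.

Lemma smash_src_mul a b : smash_src (a ** b) = smash_src a ** smash_src b.
Proof. by rewrite smash_srcE. Qed.

Lemma smash_tgt_linear : linear smash_tgt.
Proof. exact: (coact_linear (DY_comodule (bc_DY B))). Qed.

Lemma smash_tgt_mul a b : smash_tgt (a ** b) = smash_tgt b ** smash_tgt a.
Proof.
rewrite [in RHS]/smash_tgt [coact a]tens_sum mul_tlift.
rewrite /smash_tgt (coact_algM (bc_comodule_algebra B)).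
by apply: eq_tlift => a0 a1; rewrite -smash_tgtE.
Qed.

Lemma smash_tgt_one : smash_tgt aone = aone.
Proof. exact: (coact_alg1 (bc_comodule_algebra B)). Qed.

Lemma smash_src_tgt a b :
  smash_src a ** smash_tgt b = smash_tgt b ** smash_src a.
Proof.
rewrite /smash_src smash_tgtE {1}/smash_tgt {1}[coact b]tens_sum mul_tlift.
by apply: eq_tlift => b0 b1; rewrite smash_srcE amul1l.
Qed.

Notation LL := (tensB smash_src smash_tgt).

Definition smash_comul (X : smash) : LL :=
  \sw_(a, h <- X) \sw_(h1, h2 <- comul h)
    ((a ⊗ h1 : smash) ⊗ (aone ⊗ h2 : smash)).

Definition smash_counit (X : smash) : B := \sw_(a, h <- X) (counit h *: a).

Lemma smash_comul_linear : linear smash_comul.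
Proof. by rewrite /smash_comul; lin. Qed.

Lemma smash_counit_linear : linear smash_counit.
Proof. by rewrite /smash_counit; lin. Qed.

Lemma smash_comulE (a : B) (h : H) :
  smash_comul (a ⊗ h) = \sw_(h1, h2 <- comul h)
    ((a ⊗ h1 : smash) ⊗ (aone ⊗ h2 : smash)).
Proof. by rewrite /smash_comul tlift_pure //; lin. Qed.

Lemma smash_counitE (a : B) (h : H) : smash_counit (a ⊗ h) = counit h *: a.
Proof. by rewrite /smash_counit tlift_pure //; lin. Qed.

Lemma tensB_lift (W : lmodType k) (f : smash -> smash -> W) (a : B) (h : H) :
  bilin f ->
  balanced (fun b X => smash_tgt b ** X) (fun b X => smash_src b ** X) f ->
  tlift f (smash_comul (a ⊗ h)) = \sw_(h1, h2 <- comul h)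
    f (a ⊗ h1) (aone ⊗ h2).
Proof. by move=> *; rewrite smash_comulE tlift_tpure. Qed.

Lemma LL_balanced (b : B) (X Y : smash) :
  (smash_tgt b ** X) ⊗ Y = X ⊗ (smash_src b ** Y) :> LL.
Proof. exact: tpure_balanced. Qed.

Lemma LL_tgt (b a : B) (h : H) (Y : smash) :
  (a ⊗ h : smash) ⊗ (smash_src b ** Y) =
  \sw_(b0, b1 <- coact b) (((a ** b0) ⊗ (h ** b1) : smash) ⊗ Y) :> LL.
Proof.
rewrite -LL_balanced smash_tgtE.
have hl : linear (fun z : smash => z ⊗ Y : LL) by lin.
by rewrite (tlift_comp _ _ hl).
Qed.

Lemma smash_comul_bimod b c X :
  smash_comul (smash_src b ** smash_tgt c ** X) =
  \sw_(X1, X2 <- smash_comul X)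
    ((smash_src b ** X1) ⊗ (smash_tgt c ** X2) : LL).
Proof.
have fb : bilin (fun X1 X2 : smash =>
    (smash_src b ** X1) ⊗ (smash_tgt c ** X2) : LL) by lin.
have fB : balanced (fun b X => smash_tgt b ** X) (fun b X => smash_src b ** X)
    (fun X1 X2 : smash => (smash_src b ** X1) ⊗ (smash_tgt c ** X2) : LL).
  move=> d Y Z; rewrite amulA smash_src_tgt -amulA LL_balanced.
  by rewrite !amulA smash_src_tgt.
move: X; apply: smash_ext => [||a h].
- apply: (lin_comp smash_comul_linear); lin.
- by apply: (lin_comp (tlift_linear fb fB)); exact: smash_comul_linear.
rewrite tensB_lift // -amulA smash_tgtE mul_tlift.
rewrite (tlift_comp _ _ smash_comul_linear).
transitivity (\sw_(c0, c1 <- coact c) \sw_(h1, h2 <- comul h)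
    \sw_(x, y <- comul c1)
    ((((b ** a) ** c0) ⊗ (h1 ** x) : smash) ⊗
     (aone ⊗ (h2 ** y) : smash) : LL)).
  apply: eq_tlift => c0 c1; rewrite smash_srcE smash_comulE comul_mul.
  rewrite tlift_tlift; [|lin|lin].
  by apply: eq_tlift => h1 h2; rewrite tlift_tpure ?amulA //; lin.
rewrite tlift_exchange; apply: eq_tlift => h1 h2.
rewrite -(coact3 (F := fun c0 x y => (((b ** a) ** c0) ⊗ (h1 ** x) : smash) ⊗
     (aone ⊗ (h2 ** y) : smash) : LL)); try by move=> *; lin.
rewrite smash_srcE smash_tgtE.
have hl : linear (fun z : smash => ((b ** a) ⊗ h1 : smash) ⊗ z : LL) by lin.
rewrite (tlift_comp _ _ hl); apply: eq_tlift => c0 c1.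
by rewrite -LL_tgt amul1l smash_srcE amul1r.
Qed.

Lemma smash_counit_bimod b c X :
  smash_counit (smash_src b ** smash_tgt c ** X) =
  b ** smash_counit X ** c.
Proof.
move: X; apply: smash_ext => [||a h].
- apply: (lin_comp smash_counit_linear); lin.
- apply: lin_mull; apply: lin_mulr; exact: smash_counit_linear.
rewrite smash_counitE -amulA smash_tgtE mul_tlift.
rewrite (tlift_comp _ _ smash_counit_linear).
have hl : linear (fun z : B => counit h *: (b ** a ** z)) by lin.
rewrite amulZr amulZl -(coact_counit_lin c hl).
apply: eq_tlift => c0 c1; rewrite smash_srcE smash_counitE counit_mul amulA.
by rewrite scalerA mulrC.
Qed.

Definition LL_lact (b : B) (Z : LL) : LL :=
  \sw_(X, Y <- Z) ((smash_src b ** X) ⊗ Y).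

Lemma LL_lact_bal b : 
  balanced (fun b X => smash_tgt b ** X) (fun b X => smash_src b ** X)
    (fun X Y : smash => (smash_src b ** X) ⊗ Y : LL).
Proof. by move=> d X Y; rewrite amulA smash_src_tgt -amulA LL_balanced. Qed.

Lemma smash_comul_src b X :
  smash_comul (smash_src b ** X) = LL_lact b (smash_comul X).
Proof.
have := smash_comul_bimod b aone X; rewrite smash_tgt_one amul1r => ->.
by apply: eq_tlift => X1 X2; rewrite amul1l.
Qed.

Lemma smash_comul_tgt b X :
  smash_comul (smash_tgt b ** X) =
  \sw_(X1, X2 <- smash_comul X) (X1 ⊗ (smash_tgt b ** X2) : LL).
Proof.
have := smash_comul_bimod aone b X.
rewrite [smash_src aone]/(aone : smash) amul1l => ->.
by apply: eq_tlift => X1 X2; rewrite amul1l.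
Qed.

Notation L3 := (tensB3 smash_src smash_tgt).

Lemma smash_coassoc (X : smash) :
  \sw_(X1, X2 <- smash_comul X) \sw_(X11, X12 <- smash_comul X1)
    (X11 ⊗ (X12 ⊗ X2) : L3)
  = \sw_(X1, X2 <- smash_comul X) (X1 ⊗ smash_comul X2).
Proof.
have lb (X1 X2 Y : smash) b : ((smash_tgt b ** X1) ⊗ (X2 ⊗ Y) : L3) =
    X1 ⊗ ((smash_src b ** X2) ⊗ Y).
  rewrite tpure_balanced tlift_pure //; first by lin.
  exact: LL_lact_bal.
have iB (Y : smash) : balanced (fun b X => smash_tgt b ** X)
    (fun b X => smash_src b ** X)
    (fun X1 X2 : smash => X1 ⊗ (X2 ⊗ Y) : L3).
  by move=> b X1 X2; rewrite lb.
have lB : balanced (fun b X => smash_tgt b ** X) (fun b X => smash_src b ** X)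
    (fun X1 X2 => \sw_(X11, X12 <- smash_comul X1) (X11 ⊗ (X12 ⊗ X2) : L3)).
  move=> b X1 X2; rewrite smash_comul_tgt tlift_tpure //; last by lin.
  by apply: eq_tlift => Y1 Y2; rewrite LL_balanced.
have lb' : bilin (fun X1 X2 =>
    \sw_(X11, X12 <- smash_comul X1) (X11 ⊗ (X12 ⊗ X2) : L3)).
  split=> Y; last by lin.
  apply: (lin_comp (tlift_linear _ _) smash_comul_linear); last exact: iB.
  by lin.
have rb : bilin (fun X1 X2 => X1 ⊗ smash_comul X2 : L3).
  split=> Y; first by lin.
  by apply: lin_purer; exact: smash_comul_linear.
have rB : balanced (fun b X => smash_tgt b ** X) (fun b X => smash_src b ** X)
    (fun X1 X2 => X1 ⊗ smash_comul X2 : L3).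
  by move=> b X1 X2; rewrite smash_comul_src tpure_balanced.
move: X; apply: smash_ext => [||a h].
- exact: (lin_comp (tlift_linear lb' lB) smash_comul_linear).
- exact: (lin_comp (tlift_linear rb rB) smash_comul_linear).
rewrite !tensB_lift //.
transitivity (\sw_(x, y <- comul h) \sw_(x1, x2 <- comul x)
  ((a ⊗ x1 : smash) ⊗ ((aone ⊗ x2 : smash) ⊗ (aone ⊗ y : smash)) : L3)).
  by apply: eq_tlift => x y; rewrite tensB_lift //; lin.
rewrite (comul3 (F := fun x y z =>
  ((a ⊗ x : smash) ⊗ ((aone ⊗ y : smash) ⊗ (aone ⊗ z : smash)) : L3)));
  try by move=> *; lin.
apply: eq_tlift => x y; rewrite smash_comulE.
have hl : linear (fun Z : LL => (a ⊗ x : smash) ⊗ Z : L3) by lin.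
by rewrite (tlift_comp _ _ hl).
Qed.

Lemma smash_counitl X :
  \sw_(X1, X2 <- smash_comul X) (smash_src (smash_counit X1) ** X2) = X.
Proof.
have fb : bilin (fun X1 X2 => smash_src (smash_counit X1) ** X2).
  split=> Y; last by lin.
  apply: lin_mull; apply: (lin_comp smash_src_linear).
  exact: smash_counit_linear.
have fB : balanced (fun b X => smash_tgt b ** X) (fun b X => smash_src b ** X)
    (fun X1 X2 => smash_src (smash_counit X1) ** X2).
  move=> b X1 X2; have := smash_counit_bimod aone b X1.
  rewrite [smash_src aone]/(aone : smash) !amul1l => ->.
  by rewrite smash_src_mul amulA.
move: X; apply: smash_ext => [||a h].
- exact: (lin_comp (tlift_linear fb fB) smash_comul_linear).
- by [].
have hl : linear (fun z => a ⊗ z : smash) by lin.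
rewrite tensB_lift // -(comul_counitl_lin h hl); apply: eq_tlift => x y.
by rewrite smash_counitE smash_srcE amul1r tpureZl.
Qed.

Lemma smash_counitr X :
  \sw_(X1, X2 <- smash_comul X) (smash_tgt (smash_counit X2) ** X1) = X.
Proof.
have fb : bilin (fun X1 X2 => smash_tgt (smash_counit X2) ** X1).
  split=> Y; first by lin.
  apply: lin_mull; apply: (lin_comp smash_tgt_linear).
  exact: smash_counit_linear.
have fB : balanced (fun b X => smash_tgt b ** X) (fun b X => smash_src b ** X)
    (fun X1 X2 => smash_tgt (smash_counit X2) ** X1).
  move=> b X1 X2; have := smash_counit_bimod b aone X2.
  rewrite smash_tgt_one !amul1r => ->.
  by rewrite smash_tgt_mul amulA.
move: X; apply: smash_ext => [||a h].
- exact: (lin_comp (tlift_linear fb fB) smash_comul_linear).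
- by [].
have hl : linear (fun z => a ⊗ z : smash) by lin.
rewrite tensB_lift // -(comul_counitr_lin h hl); apply: eq_tlift => x y.
rewrite smash_counitE (linZ _ _ smash_tgt_linear) smash_tgt_one.
by rewrite amulZl amul1l.
Qed.

Lemma smash_mulsrcE (a b : B) (h : H) :
  (a ⊗ h : smash) ** smash_src b =
  \sw_(h1, h2 <- comul h) ((a ** act b h1) ⊗ h2).
Proof.
by rewrite smash_pureE; apply: eq_tlift => x y; rewrite amul1l.
Qed.

Lemma smash_multgtE (a b : B) (h : H) :
  (a ⊗ h : smash) ** smash_tgt b =
  \sw_(b0, b1 <- coact b) \sw_(h1, h2 <- comul h)
     ((a ** act b0 h1) ⊗ (b1 ** h2)).
Proof.
rewrite /smash_tgt {1}[coact b]tens_sum mul_tlift.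
by apply: eq_tlift => b0 b1; rewrite smash_pureE.
Qed.

Lemma takeuchi_bal_l b : balanced (fun b X => smash_tgt b ** X)
  (fun b X => smash_src b ** X)
  (fun X1 X2 : smash => (X1 ** smash_tgt b) ⊗ X2 : LL).
Proof. by move=> c X Y; rewrite -amulA LL_balanced. Qed.

Lemma takeuchi_bal_r b : balanced (fun b X => smash_tgt b ** X)
  (fun b X => smash_src b ** X)
  (fun X1 X2 : smash => X1 ⊗ (X2 ** smash_src b) : LL).
Proof. by move=> c X Y; rewrite LL_balanced amulA. Qed.

Lemma smash_takeuchi X b :
  \sw_(X1, X2 <- smash_comul X) ((X1 ** smash_tgt b) ⊗ X2 : LL)
  = \sw_(X1, X2 <- smash_comul X) (X1 ⊗ (X2 ** smash_src b)).
Proof.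
have fB := takeuchi_bal_l b; have gB := takeuchi_bal_r b.
have fb : bilin (fun X1 X2 : smash => (X1 ** smash_tgt b) ⊗ X2 : LL) by lin.
have gb : bilin (fun X1 X2 : smash => X1 ⊗ (X2 ** smash_src b) : LL) by lin.
move: X; apply: smash_ext => [||a h].
- exact: (lin_comp (tlift_linear fb fB) smash_comul_linear).
- exact: (lin_comp (tlift_linear gb gB) smash_comul_linear).
rewrite !tensB_lift //.
transitivity (\sw_(x, y <- comul h) \sw_(x1, x2 <- comul x)
  \sw_(b0, b1 <- coact b)
   (((a ** act b0 x1) ⊗ (b1 ** x2) : smash) ⊗ (aone ⊗ y : smash) : LL)).
  apply: eq_tlift => x y; rewrite smash_multgtE tlift_exchange.
  have hl : linear (fun z : smash => z ⊗ (aone ⊗ y : smash) : LL) by lin.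
  rewrite (tlift_comp _ _ hl); apply: eq_tlift => x1 x2.
  by rewrite (tlift_comp _ _ hl).
transitivity (\sw_(x, y <- comul h) \sw_(x1, x2 <- comul x)
  \sw_(b0, b1 <- coact (act b x2))
   (((a ** b0) ⊗ (x1 ** b1) : smash) ⊗ (aone ⊗ y : smash) : LL)).
  apply: eq_tlift => x y.
  have := DY_compat (bc_DY B) b x.
  move=> /(congr1 (fun t => \sw_(c0, c1 <- t)
    (((a ** c0) ⊗ c1 : smash) ⊗ (aone ⊗ y : smash) : LL))).
  have Gb : bilin (fun c0 c1 =>
    ((a ** c0) ⊗ c1 : smash) ⊗ (aone ⊗ y : smash) : LL) by lin.
  rewrite !(tlift_tlift _ _ Gb); [|lin|lin].
  move=> e; rewrite tlift_exchange.
  transitivity (\sw_(b0, b1 <- coact b)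
    tlift (fun c0 c1 => ((a ** c0) ⊗ c1 : smash) ⊗ (aone ⊗ y : smash) : LL)
      (\sw_(h1, h2 <- comul x) (act b0 h1 ⊗ (b1 ** h2) : tensor B H))).
    by apply: eq_tlift => b0 b1; rewrite tlift_tpure //; lin.
  rewrite -e; apply: eq_tlift => x1 x2.
  by rewrite tlift_tpure //; lin.
rewrite (comul3 (F := fun x y z => \sw_(b0, b1 <- coact (act b y))
   (((a ** b0) ⊗ (x ** b1) : smash) ⊗ (aone ⊗ z : smash) : LL)));
  try by move=> *; lin.
apply: eq_tlift => x y; rewrite smash_mulsrcE.
have hl : linear (fun z : smash => (a ⊗ x : smash) ⊗ z : LL) by lin.
rewrite (tlift_comp _ _ hl); apply: eq_tlift => y1 y2.
by rewrite -LL_tgt smash_srcE amul1r amul1l.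
Qed.

Lemma smash_comul_mul X Y :
  smash_comul (X ** Y) =
  \sw_(Y1, Y2 <- smash_comul Y) \sw_(X1, X2 <- smash_comul X)
    ((X1 ** Y1) ⊗ (X2 ** Y2) : LL).
Proof.
have iB Y1 Y2 : balanced (fun b X => smash_tgt b ** X)
    (fun b X => smash_src b ** X)
    (fun X1 X2 : smash => (X1 ** Y1) ⊗ (X2 ** Y2) : LL).
  by move=> b X1 X2; rewrite -!amulA LL_balanced.
have ib Y1 Y2 : bilin (fun X1 X2 : smash => (X1 ** Y1) ⊗ (X2 ** Y2) : LL).
  by lin.
have oB X' : balanced (fun b X => smash_tgt b ** X)
    (fun b X => smash_src b ** X)
    (fun Y1 Y2 => \sw_(X1, X2 <- smash_comul X')
      ((X1 ** Y1) ⊗ (X2 ** Y2) : LL)).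
  move=> b Y1 Y2; have := smash_takeuchi X' b.
  move=> /(congr1 (tlift (fun X1 X2 => (X1 ** Y1) ⊗ (X2 ** Y2) : LL))).
  rewrite !tlift_tpure // => e.
  transitivity (\sw_(x, y <- smash_comul X')
    (x ** smash_tgt b ** Y1 ⊗ y ** Y2 : LL)).
    by apply: eq_tlift => X1 X2; rewrite amulA.
  by rewrite e; apply: eq_tlift => X1 X2; rewrite amulA.
have ob X' : bilin (fun Y1 Y2 => \sw_(X1, X2 <- smash_comul X')
      ((X1 ** Y1) ⊗ (X2 ** Y2) : LL)) by lin.
move: X; apply: smash_ext => [||a h].
- by apply: (lin_comp smash_comul_linear); lin.
- apply: lin_tliftl => Y1 Y2.
  exact: (lin_comp (tlift_linear (ib _ _) (iB _ _)) smash_comul_linear).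
move: Y; apply: smash_ext => [||b g].
- by apply: (lin_comp smash_comul_linear); lin.
- exact: (lin_comp (tlift_linear (ob _) (oB _)) smash_comul_linear).
rewrite tensB_lift // smash_pureE (tlift_comp _ _ smash_comul_linear).
transitivity (\sw_(g1, g2 <- comul g) \sw_(x, y <- comul h)
    \sw_(y1, y2 <- comul y)
    (((a ** act b x) ⊗ (g1 ** y1) : smash) ⊗ (aone ⊗ (g2 ** y2) : smash) : LL)).
  rewrite tlift_exchange; apply: eq_tlift => x y.
  rewrite smash_comulE comul_mul tlift_tlift; [|lin|lin].
  by apply: eq_tlift => g1 g2; rewrite tlift_tpure //; lin.
apply: eq_tlift => g1 g2; rewrite tensB_lift //.
rewrite -(comul3 (F := fun x y z => ((a ** act b x) ⊗ (g1 ** y) : smash) ⊗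
  (aone ⊗ (g2 ** z) : smash) : LL)); try by move=> *; lin.
apply: eq_tlift => x y; rewrite !smash_pureE.
have hl Z : linear (fun z : smash => z ⊗ Z : LL) by lin.
rewrite (tlift_comp _ _ (hl _)).
have -> : (\sw_(h1, h2 <- comul y) (aone ** act aone h1 ⊗ (g2 ** h2))
   = (aone ⊗ (g2 ** y) : smash)).
  have hl' : linear (fun z => aone ⊗ (g2 ** z) : smash) by lin.
  rewrite -(comul_counitl_lin y hl'); apply: eq_tlift => y1 y2.
  by rewrite (act_alg1 (bc_module_algebra B)) amul1l tpureZl.
by [].
Qed.

Lemma smash_comul_one : smash_comul aone = aone ⊗ aone.
Proof. by rewrite smash_comulE comulE1; last by lin. Qed.

Lemma smash_counit_mul_pure (a b : B) (h g : H) :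
  smash_counit ((a ⊗ h : smash) ** (b ⊗ g : smash)) =
  counit g *: (a ** act b h).
Proof.
rewrite smash_pureE (tlift_comp _ _ smash_counit_linear).
have hl : linear (fun z => counit g *: (a ** act b z)) by lin.
rewrite -(comul_counitr_lin h hl); apply: eq_tlift => x y.
by rewrite smash_counitE counit_mul scalerA mulrC.
Qed.

Lemma smash_counit_src X Y :
  smash_counit (X ** Y) = smash_counit (X ** smash_src (smash_counit Y)).
Proof.
move: X; apply: smash_ext => [||a h].
- by apply: (lin_comp smash_counit_linear); lin.
- by apply: (lin_comp smash_counit_linear); lin.
move: Y; apply: smash_ext => [||b g].
- by apply: (lin_comp smash_counit_linear); lin.
- apply: (lin_comp smash_counit_linear); apply: lin_mulr.
  by apply: (lin_comp smash_src_linear); exact: smash_counit_linear.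
rewrite smash_counitE !smash_counit_mul_pure counit_one scale1r.
by rewrite (linZ _ _ (act_linl (DY_module (bc_DY B)) h)) amulZr.
Qed.

Lemma smash_counit_tgt X Y :
  smash_counit (X ** Y) = smash_counit (X ** smash_tgt (smash_counit Y)).
Proof.
rewrite smash_counit_src; set b := smash_counit Y.
move: X; apply: smash_ext => [||a h].
- by apply: (lin_comp smash_counit_linear); lin.
- by apply: (lin_comp smash_counit_linear); lin.
rewrite smash_counit_mul_pure counit_one scale1r.
rewrite /smash_tgt [coact b]tens_sum mul_tlift.
rewrite (tlift_comp _ _ smash_counit_linear).
have hl : linear (fun z => a ** act z h) by lin.
rewrite -(coact_counit_lin b hl); apply: eq_tlift => b0 b1.
by rewrite smash_counit_mul_pure.
Qed.

Lemma smash_counit_one : smash_counit aone = aone.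
Proof. by rewrite smash_counitE counit_one scale1r. Qed.

Definition actionHopfAlgebroid : leftBialgebroid B :=
  LeftBialgebroid smash_src_linear smash_src_mul erefl smash_tgt_linear
    smash_tgt_mul smash_tgt_one smash_src_tgt smash_comul_linear
    smash_comul_bimod smash_counit_linear smash_counit_bimod smash_coassoc
    smash_counitl smash_counitr smash_takeuchi smash_comul_mul smash_comul_one
    smash_counit_src smash_counit_tgt smash_counit_one.

End Smash.

Arguments src {k B l}.
Arguments tgt {k B l}.

Record is_alg_aut (k : fieldType) (B : kAlgType k) (f : B -> B) : Prop :=
  IsAlgAut {
  aut_linear : linear f;
  aut_mul : forall a b, f (a ** b) = f a ** f b;
  aut_one : f aone = aone;
  aut_bij : bijective f }.

Record is_left_bisection (k : fieldType) (B : kAlgType k)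
    (L : leftBialgebroid B) (sigma : L -> B) : Prop := IsLeftBisection {
  lbis_linear : linear sigma;
  lbis_one : sigma aone = aone;
  lbis_tgt : forall (b : B) (X : L), sigma (tgt b ** X) = sigma X ** b;
  lbis_aut : is_alg_aut (fun b => sigma (src b));
  lbis_mul_tgt : forall X Y : L, sigma (X ** Y) = sigma (X ** tgt (sigma Y));
  lbis_mul_src : forall phiV : B -> B,
    cancel (fun b => sigma (src b)) phiV ->
    cancel phiV (fun b => sigma (src b)) ->
    forall X Y : L, sigma (X ** Y) = sigma (X ** src (phiV (sigma Y))) }.

Record is_right_bisection (k : fieldType) (B : kAlgType k)
    (L : leftBialgebroid B) (sigma : L -> B) : Prop := IsRightBisection {
  rbis_linear : linear sigma;
  rbis_one : sigma aone = aone;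
  rbis_src : forall (b : B) (X : L), sigma (src b ** X) = b ** sigma X;
  rbis_aut : is_alg_aut (fun b => sigma (tgt b));
  rbis_mul_src : forall X Y : L, sigma (X ** Y) = sigma (X ** src (sigma Y));
  rbis_mul_tgt : forall psiV : B -> B,
    cancel (fun b => sigma (tgt b)) psiV ->
    cancel psiV (fun b => sigma (tgt b)) ->
    forall X Y : L, sigma (X ** Y) = sigma (X ** tgt (psiV (sigma Y))) }.

Definition left_bis_mul (k : fieldType) (B : kAlgType k)
    (L : leftBialgebroid B) (sigma eta : L -> B) (X : L) : B :=
  \sw_(X1, X2 <- bd_comul X) sigma (src (eta X1) ** X2).

Definition right_bis_mul (k : fieldType) (B : kAlgType k)
    (L : leftBialgebroid B) (sigma eta : L -> B) (X : L) : B :=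
  \sw_(X1, X2 <- bd_comul X) sigma (tgt (eta X2) ** X1).

Section Cocycles.
Variables (k : fieldType) (H : hopfAlgebra k) (B : braidedCommAlgebra H).

Definition cocycle_psi (rho : H -> B) (b : B) : B :=
  \sw_(b0, b1 <- coact b) (b0 ** rho b1).

Record is_cocycle (rho : H -> B) : Prop := IsCocycle {
  coc_linear : linear rho;
  coc_one : rho aone = aone;
  coc_mul : forall g h,
    rho (g ** h) = \sw_(h1, h2 <- comul h) (act (rho g) h1 ** rho h2);
  coc_bij : bijective (cocycle_psi rho) }.

Definition cocycle_mul (rho rho' : H -> B) (h : H) : B :=
  \sw_(h1, h2 <- comul h) (rho h1 ** cocycle_psi rho (rho' h2)).

Definition cocycle_unit (h : H) : B := counit h *: aone.

End Cocycles.

(* A set with a candidate group structure: the operation is defined on the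
   ambient type, and the group axioms are required on the carrier only. *)
Record setOp := SetOp {
  so_type : Type;
  so_set : set so_type;
  so_mul : so_type -> so_type -> so_type;
  so_unit : so_type }.

Arguments so_set : clear implicits.
Arguments so_unit : clear implicits.

Record is_group (G : setOp) : Prop := IsGroup {
  group_mulP : forall x y, so_set G x -> so_set G y -> so_set G (so_mul x y);
  group_unitP : so_set G (so_unit G);
  group_mulA : forall x y z, so_set G x -> so_set G y -> so_set G z ->
    so_mul x (so_mul y z) = so_mul (so_mul x y) z;
  group_mul1l : forall x, so_set G x -> so_mul (so_unit G) x = x;
  group_mul1r : forall x, so_set G x -> so_mul x (so_unit G) = x;
  group_inv : forall x, so_set G x -> exists y,
    [/\ so_set G y, so_mul y x = so_unit G & so_mul x y = so_unit G] }.

Definition opposite (G : setOp) : setOp :=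
  SetOp (so_set G) (fun x y => so_mul y x) (so_unit G).

Definition group_iso (G K : setOp) : Prop :=
  exists f : so_type G -> so_type K,
    set_bij (so_set G) (so_set K) f /\
    forall x y, so_set G x -> so_set G y -> f (so_mul x y) = so_mul (f x) (f y).

Definition leftBisections (k : fieldType) (B : kAlgType k)
    (L : leftBialgebroid B) : setOp :=
  SetOp [set sigma : L -> B | is_left_bisection sigma]
    (@left_bis_mul k B L) (@bd_counit k B L).

Definition rightBisections (k : fieldType) (B : kAlgType k)
    (L : leftBialgebroid B) : setOp :=
  SetOp [set sigma : L -> B | is_right_bisection sigma]
    (@right_bis_mul k B L) (@bd_counit k B L).

Definition cocycles (k : fieldType) (H : hopfAlgebra k)
    (B : braidedCommAlgebra H) : setOp :=
  SetOp [set rho : H -> B | is_cocycle rho]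
    (@cocycle_mul k H B) (@cocycle_unit k H B).

(* Main.v *)
Require Import Defs.
From HB Require Import structures.
From mathcomp Require Import all_boot all_order all_algebra.
From mathcomp Require Import boolp classical_sets functions.

Set Implicit Arguments. Unset Strict Implicit. Unset Printing Implicit Defensive.
Import GRing.Theory.
Local Open Scope ring_scope.

(** Why the theorem holds.

    A right bisection sigma of B#H^op is left B-linear, so it is
    [a#h |-> a ** rho h] with [rho h = sigma (1#h)]. The condition
    [sigma (XY) = sigma (X s(sigma Y))] then says exactly that
    [rho (gh) = (rho g <| h_1) rho h_2], while [sigma (t b)] is
    [psi b = b_0 rho (b_1)]. That psi is an algebra map comes for free: braided
    commutativity and the crossed law give
    [b_0 rho (g b_1) = rho g ** psi b] ([psi_shift]), hence [psi_mul]. So right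
    bisections and cocycles correspond ([cocycle_bis_bij]), and the products
    match because [sigma (t(c) X) = sigma X ** psi c] ([rbis_tgt]).

    Right and left bisections are related over every left bialgebroid: the map
    [sigma |-> psi^-1 o sigma], where [psi = sigma o t], exchanges the two
    lists of axioms, with inverse [sigma |-> phi^-1 o sigma], [phi = sigma o s]
    ([right_to_leftP], [left_to_rightP]). As the automorphism attached to a
    product of right bisections is the composite of the two automorphisms, this
    map reverses products ([right_to_left_mul]).

    It remains to see that cocycles form a group; the other two group
    structures are then transported along these bijections
    ([is_group_transport]). Everything takes place in the convolution algebra
    of linear maps H -> B, with [f * g : h |-> f h_1 ** g h_2]. There
    [b |-> (h |-> b <| h)] is multiplicative, the crossed law reads
    [rho (g -) = (rho g <| -) * rho], the product of cocycles is
    [rho * (psi o rho')], and the Drinfeld-Yetter compatibility becomes the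
    commutation rule [rho * psi (b <| -) = (psi b <| -) * rho] ([psi_act]).
    These identities make products of cocycles cocycles. For inverses, a crossed
    map rho has the convolution inverse [rho^- h = rho (S h_1) <| h_2], where
    S is the antipode, and the inverse cocycle is [psi^-1 o rho^-]
    ([cocycle_inv]). *)

(** Linearity in one variable, allowing maps that are linear by hypothesis on
    top of the structural operations. *)
Ltac lins :=
  lin; try first
  [ exact: (coact_linear (DY_comodule (bc_DY _)))
  | match goal with h : @GRing.linear_for _ _ _ _ _ |- _ => exact: h end
  | match goal with h : @GRing.linear_for _ _ _ _ _ |- _ =>
      apply: (lin_comp h); lins end
  | match goal with h : forall _, @GRing.linear_for _ _ _ _ _ |- _ =>
      apply: (lin_comp (h _)); lins end ].

(** * Convolution of linear maps from a Hopf algebra to an algebra *)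

Section Convolution.
Variables (k : fieldType) (H : hopfAlgebra k).
Implicit Type A : kAlgType k.

Definition conv A (f g : H -> A) (h : H) : A :=
  \sw_(x, y <- comul h) (f x ** g y).

Definition conv1 A (h : H) : A := counit h *: aone.

Lemma conv_linear A (f g : H -> A) :
  linear f -> linear g -> linear (conv f g).
Proof. by move=> fl gl; rewrite /conv; lins. Qed.

Lemma conv1_linear A : linear (@conv1 A).
Proof. by rewrite /conv1; lins. Qed.

Lemma convA A (f g e : H -> A) : linear f -> linear g -> linear e ->
  conv f (conv g e) = conv (conv f g) e.
Proof.
move=> fl gl el; apply/funext => h; rewrite /conv.
transitivity (\sw_(x, y <- comul h) \sw_(y1, y2 <- comul y)
  (f x ** g y1 ** e y2)).
  by apply: eq_tlift => x y; rewrite mul_tlift;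
    apply: eq_tlift => *; rewrite amulA.
rewrite -(comul3 (F := fun x y z => f x ** g y ** e z)); last first.
- by move=> *; lins.
- by move=> *; lins.
- by move=> *; lins.
by apply: eq_tlift => x y; rewrite tlift_mul.
Qed.

Lemma conv1l A (f : H -> A) : linear f -> conv (@conv1 A) f = f.
Proof.
move=> fl; apply/funext => h; rewrite -[RHS](comul_counitl_lin h fl).
by apply: eq_tlift => x y; rewrite /conv1 amulZl amul1l.
Qed.

Lemma conv1r A (f : H -> A) : linear f -> conv f (@conv1 A) = f.
Proof.
move=> fl; apply/funext => h; rewrite -[RHS](comul_counitr_lin h fl).
by apply: eq_tlift => x y; rewrite /conv1 amulZr amul1r.
Qed.

(** The usual monoid argument: a left inverse of g equals a right inverse of g. *)
Lemma conv_inverse_unique A (f g e : H -> A) :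
  linear f -> linear g -> linear e ->
  conv f g = @conv1 A -> conv g e = @conv1 A -> f = e.
Proof.
move=> fl gl el fg ge.
by rewrite -(conv1r fl) -ge convA // fg conv1l.
Qed.

End Convolution.
Arguments conv1 {k H A}.

(** * The antipode reverses the comultiplication *)

Section TensorAlgebra.
Variables (k : fieldType) (A : kAlgType k).

(** An alias of the tensor square, so that the componentwise product does not
    compete with other algebra structures on the same space. *)
Definition tensorAlg : Type := tensor A A.
HB.instance Definition _ := GRing.Lmodule.on tensorAlg.

Definition tensor_mul (s t : tensorAlg) : tensorAlg :=
  \sw_(a, b <- s) \sw_(c, d <- t) ((a ** c) ⊗ (b ** d)).

Lemma tensor_mul_linl t : linear (tensor_mul^~ t).
Proof. by rewrite /tensor_mul; lin. Qed.

Lemma tensor_mul_linr s : linear (tensor_mul s).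
Proof. by rewrite /tensor_mul; lin. Qed.

Lemma tensor_mul_pure (a b c d : A) :
  tensor_mul (a ⊗ b) (c ⊗ d) = (a ** c) ⊗ (b ** d).
Proof. by rewrite /tensor_mul tlift_pure; [rewrite tlift_pure; lin|lin|lin]. Qed.

Lemma tensor_mulA : associative tensor_mul.
Proof.
move=> s t w.
move: s; apply: tens_ext => [||a b].
- exact: tensor_mul_linl.
- exact: (lin_comp (tensor_mul_linl w) (tensor_mul_linl t)).
move: t; apply: tens_ext => [||c d].
- exact: (lin_comp (tensor_mul_linr _) (tensor_mul_linl w)).
- exact: (lin_comp (tensor_mul_linl w) (tensor_mul_linr _)).
move: w; apply: tens_ext => [||e f].
- exact: (lin_comp (tensor_mul_linr _) (tensor_mul_linr _)).
- exact: tensor_mul_linr.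
by rewrite !tensor_mul_pure !amulA.
Qed.

Lemma tensor_mul1l : left_id (aone ⊗ aone) tensor_mul.
Proof.
apply: tens_ext => [||a b]; [exact: tensor_mul_linr|by []|].
by rewrite tensor_mul_pure !amul1l.
Qed.

Lemma tensor_mul1r : right_id (aone ⊗ aone) tensor_mul.
Proof.
apply: tens_ext => [||a b]; [exact: tensor_mul_linl|by []|].
by rewrite tensor_mul_pure !amul1r.
Qed.

HB.instance Definition _ := isUnitalAlgebra.Build k tensorAlg
  tensor_mulA tensor_mul1l tensor_mul1r tensor_mul_linl tensor_mul_linr.

End TensorAlgebra.

Section Antipode.
Variables (k : fieldType) (H : hopfAlgebra k).
Local Notation S := (@antipode k H).
Local Notation HH := (tensorAlg H).

Lemma comul_morph (g h : H) :
  (comul (g ** h) : HH) = (comul g : HH) ** (comul h : HH).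
Proof. exact: comul_mul. Qed.

(** Both sides are convolution inverses, with values in [H ⊗ H], of the
    comultiplication: the left one because comul is an algebra map, the right
    one by cancelling [h_2 S(h_3)] and then [h_1 S(h_2)] inside
    [h_1 S(h_4) ⊗ h_2 S(h_3)]. *)
Lemma comul_antipode (h : H) :
  comul (S h) = \sw_(x, y <- comul h) (S y ⊗ S x : tensor H H).
Proof.
have Sl : linear S := @antipode_linear k H.
have cl : linear (@comul k H) := @comul_linear k H.
pose P (h : H) : HH := comul (S h).
pose D (h : H) : HH := comul h.
pose Q (h : H) : HH := \sw_(x, y <- comul h) (S y ⊗ S x).
have Pl : linear P by exact: (lin_comp cl Sl).
have Dl : linear D by [].
have Ql : linear Q by rewrite /Q; lins.
suff : P = Q by move=> /(congr1 (fun f => f h)).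
apply: (conv_inverse_unique Pl Dl Ql); apply/funext => g.
  transitivity (comul (\sw_(x, y <- comul g) (S x ** y))).
    by rewrite tlift_comp //; apply: eq_tlift => x y; rewrite comul_morph.
  by rewrite antipodel (linZ _ _ cl) comul_one.
have e1 (x y : H) : (D x ** Q y : HH) =
    \sw_(y1, y2 <- comul y) \sw_(x1, x2 <- comul x)
      ((x1 ** S y2) ⊗ (x2 ** S y1) : HH).
  rewrite /Q mul_tlift; apply: eq_tlift => y1 y2.
  rewrite /D [comul x]tens_sum; rewrite tlift_mul.
  by rewrite -tens_sum; apply: eq_tlift => x1 x2; apply: tensor_mul_pure.
rewrite /conv.
transitivity (\sw_(x, y <- comul g) \sw_(y1, y2 <- comul y)
  \sw_(x1, x2 <- comul x) ((x1 ** S y2) ⊗ (x2 ** S y1) : HH)).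
  by apply: eq_tlift => x y; apply: e1.
rewrite -(comul3 (F := fun x y z =>
  \sw_(x1, x2 <- comul x) ((x1 ** S z) ⊗ (x2 ** S y) : HH))); last first.
- by move=> *; lins.
- by move=> *; lins.
- by move=> *; lins.
transitivity (\sw_(x, y <- comul g) ((x ** S y) ⊗ aone : HH)).
  apply: eq_tlift => x y.
  rewrite (comul3 (F := fun a b c => ((a ** S y) ⊗ (b ** S c) : HH)));
    try by move=> *; lins.
  have hl : linear (fun z => (z ** S y) ⊗ aone : HH) by lin.
  rewrite -[RHS](comul_counitr_lin x hl); apply: eq_tlift => a b.
  have hl' : linear (fun z => (a ** S y) ⊗ z : HH) by lin.
  rewrite -(tlift_comp _ _ hl') antipoder.
  exact: tpureZr.
have hl : linear (fun z => z ⊗ aone : HH) by lin.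
rewrite -(tlift_comp _ _ hl) antipoder.
exact: tpureZl.
Qed.
End Antipode.

(** * The monoid of cocycles *)

Section CocycleMonoid.
Variables (k : fieldType) (H : hopfAlgebra k) (B : braidedCommAlgebra H).
Implicit Types rho : H -> B.
Local Notation psi := (@cocycle_psi k H B).

Lemma act_conv (a b : B) : act (a ** b) = conv (act a) (act b).
Proof. by apply/funext => h; rewrite (act_algM (bc_module_algebra B)). Qed.

Lemma act_unit c : act (c *: aone : B) = (fun h => c *: conv1 h).
Proof.
apply/funext => h; rewrite (linZ _ _ (act_linl (DY_module (bc_DY B)) h)).
by rewrite (act_alg1 (bc_module_algebra B)).
Qed.

Lemma act_linearr (b : B) : linear (act b).
Proof. exact: act_linr (DY_module (bc_DY B)) b. Qed.
#[local] Hint Resolve act_linearr : core.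

Lemma act_linearl h : linear (fun b : B => act b h).
Proof. exact: act_linl (DY_module (bc_DY B)) h. Qed.

(** The cocycle law without the bijectivity of psi, as an identity between maps
    in the convolution algebra; this is the form in which it is rewritten. *)
Definition crossed_hom rho :=
  forall g, (fun h => rho (g ** h)) = conv (act (rho g)) rho.

Lemma coc_crossed_hom rho : is_cocycle rho -> crossed_hom rho.
Proof. by move=> r g; apply/funext => h; rewrite (coc_mul r). Qed.

Lemma crossed_homE rho : crossed_hom rho ->
  forall g h, rho (g ** h) = conv (act (rho g)) rho h.
Proof. by move=> rM g h; rewrite -rM. Qed.

Lemma psi_linear rho : linear rho -> linear (psi rho).
Proof. by move=> rl; rewrite /cocycle_psi; lins. Qed.

Lemma psi_one rho : linear rho -> rho aone = aone -> psi rho aone = aone.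
Proof.
move=> rl r1; rewrite /cocycle_psi (coact_alg1 (bc_comodule_algebra B)).
by rewrite tlift_pure ?r1 ?amul1l //; lins.
Qed.

(** Expanding [rho (g b_1)] by the crossed law produces
    [b_0 (rho g <| b_1) rho (b_2)], whose first two factors are
    [rho g ** b_0] by braided commutativity. *)
Lemma psi_shift rho : linear rho -> crossed_hom rho -> forall g b,
  \sw_(b0, b1 <- coact b) (b0 ** rho (g ** b1)) = rho g ** psi rho b.
Proof.
move=> rl rM g b.
transitivity (\sw_(b0, b1 <- coact b) \sw_(x, y <- comul b1)
   (b0 ** act (rho g) x ** rho y)).
  apply: eq_tlift => b0 b1; rewrite (crossed_homE rM).
  by rewrite mul_tlift; apply: eq_tlift => x y; rewrite amulA.
rewrite -(coact3 (F := fun c x y => c ** act (rho g) x ** rho y));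
  try by move=> *; lins.
rewrite mul_tlift; apply: eq_tlift => b0 b1.
by rewrite amulA (bc_comm (rho g) b0) tlift_mul.
Qed.

(** [a_0 b_0 rho (a_1 b_1)] is [a_0 rho (a_1) psi b] by [psi_shift]. *)
Lemma psi_mul rho : linear rho -> crossed_hom rho -> forall a b,
  psi rho (a ** b) = psi rho a ** psi rho b.
Proof.
move=> rl rM a b; rewrite {1}/cocycle_psi (coact_algM (bc_comodule_algebra B)).
have fb : bilin (fun c h => c ** rho h) by split=> ?; lins.
rewrite tlift_tlift //; try by lin.
rewrite {2}/cocycle_psi tlift_mul; apply: eq_tlift => a0 a1.
rewrite tlift_tpure //; try by lin.
rewrite -amulA -psi_shift // mul_tlift.
by apply: eq_tlift => b0 b1; rewrite amulA.
Qed.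

(** The Drinfeld-Yetter compatibility seen through rho. By [psi_shift] the left
    side at h is the sum of [c_0 rho (h_1 c_1)] with [c = b <| h_2]; the
    compatibility turns it into [(b_0 <| h_1) rho (b_1 h_2)], and the crossed
    law regroups this as [((b_0 rho (b_1)) <| h_1) rho h_2]. *)
Lemma psi_act rho : linear rho -> crossed_hom rho -> forall b,
  conv rho (fun h => psi rho (act b h)) = conv (act (psi rho b)) rho.
Proof.
move=> rl rM b; apply/funext => h; rewrite /conv.
transitivity (\sw_(x, y <- comul h) \sw_(c0, c1 <- coact (act b y))
    (c0 ** rho (x ** c1))).
  by apply: eq_tlift => x y; rewrite psi_shift.
have fb : bilin (fun c g => c ** rho g) by split=> ?; lins.
have /(congr1 (tlift (fun c g => c ** rho g))) := DY_compat (bc_DY B) b h.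
rewrite !tlift_tlift //; try by lin.
move=> e; transitivity (\sw_(x, y <- comul h)
    tlift (fun c g => c ** rho g) (\sw_(c0, c1 <- coact (act b y))
      (c0 ⊗ (x ** c1) : tensor B H))).
  by apply: eq_tlift => x y; rewrite tlift_tpure //; lin.
rewrite e; transitivity (\sw_(b0, b1 <- coact b)
   conv (conv (act b0) (act (rho b1))) rho h).
  apply: eq_tlift => b0 b1; rewrite -convA // -rM tlift_tpure //; by lin.
transitivity (\sw_(b0, b1 <- coact b) conv (act (b0 ** rho b1)) rho h).
  by apply: eq_tlift => b0 b1; rewrite act_conv.
rewrite /conv tlift_exchange; apply: eq_tlift => x y.
by rewrite -tlift_mul -(tlift_comp _ _ (act_linearl x)).
Qed.

Lemma cocycle_mulE rho rho' :
  cocycle_mul rho rho' = conv rho (fun h => psi rho (rho' h)).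
Proof. by []. Qed.

Lemma cocycle_mul_linear rho rho' : linear rho -> linear rho' ->
  linear (cocycle_mul rho rho').
Proof.
move=> rl rl'; apply: conv_linear => //.
exact: lin_comp (psi_linear rl) rl'.
Qed.

(** Coassociativity of the coaction lets psi absorb the first factor. *)
Lemma psi_conv rho (f : H -> B) b : linear rho -> linear f ->
  psi (conv rho f) b = \sw_(b0, b1 <- coact b) (psi rho b0 ** f b1).
Proof.
move=> rl fl.
transitivity (\sw_(b0, b1 <- coact b) \sw_(x, y <- comul b1)
   (b0 ** rho x ** f y)).
  by apply: eq_tlift => b0 b1; rewrite mul_tlift;
    apply: eq_tlift => *; rewrite amulA.
rewrite -(coact3 (F := fun c x y => c ** rho x ** f y)); try by move=> *; lins.
by apply: eq_tlift => b0 b1; rewrite -tlift_mul.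
Qed.

(** Composition of the automorphisms is what makes both the associativity of the
    product and the bijectivity clause for a product work. *)
Lemma psi_comp rho rho' : linear rho -> crossed_hom rho -> linear rho' ->
  forall b, psi (cocycle_mul rho rho') b = psi rho (psi rho' b).
Proof.
move=> rl rM rl' b; rewrite cocycle_mulE psi_conv //; last first.
  exact: lin_comp (psi_linear rl) rl'.
rewrite {2}/cocycle_psi (tlift_comp _ _ (psi_linear rl)).
by apply: eq_tlift => b0 b1; rewrite psi_mul.
Qed.

(** For [g_1], [g_2] fixed, the crossed laws and [psi_act] give
    [(rho g_1 <| -) * rho * psi (rho' g_2 <| -) * (psi o rho')
     = ((rho g_1 ** psi (rho' g_2)) <| -) * rho * (psi o rho')]. *)
Lemma cocycle_mul_crossed_hom rho rho' :
  linear rho -> crossed_hom rho -> linear rho' -> crossed_hom rho' ->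
  crossed_hom (cocycle_mul rho rho').
Proof.
move=> rl rM rl' rM' g; apply/funext => h.
have pl := psi_linear rl; have prl := lin_comp pl rl'.
have pal b := lin_comp pl (act_linearr b).
transitivity (\sw_(x, y <- comul g)
    conv (act (rho x ** psi rho (rho' y))) (cocycle_mul rho rho') h).
  rewrite {1}/cocycle_mul comul_mul.
  have fb : bilin (fun x y => rho x ** psi rho (rho' y)) by split=> ?; lins.
  rewrite tlift_tlift //; try by lin.
  apply: eq_tlift => x y; rewrite tlift_tpure //; try by lin.
  rewrite act_conv -convA //; last exact: cocycle_mul_linear.
  rewrite cocycle_mulE (convA (act_linearr _) rl prl).
  rewrite -psi_act // -convA // convA //; last exact: conv_linear.
  rewrite -rM; apply: eq_tlift => u v; congr (_ ** _).
  rewrite (crossed_homE rM').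
  rewrite /conv (tlift_comp _ _ pl).
  by apply: eq_tlift => *; rewrite psi_mul.
rewrite /conv tlift_exchange; apply: eq_tlift => x y.
by rewrite -tlift_mul -(tlift_comp _ _ (act_linearl x)).
Qed.

Lemma cocycle_mul_one rho rho' : linear rho -> linear rho' ->
  rho aone = aone -> rho' aone = aone -> cocycle_mul rho rho' aone = aone.
Proof.
move=> rl rl' r1 r1'; rewrite /cocycle_mul comulE1.
  by rewrite r1 r1' psi_one // amul1l.
by have pl := psi_linear rl; split=> ?; lins.
Qed.

Lemma crossed_hom_cocycle rho : linear rho -> rho aone = aone ->
  crossed_hom rho -> bijective (psi rho) -> is_cocycle rho.
Proof.
move=> rl r1 rM rb; split=> // g h.
by rewrite (crossed_homE rM).
Qed.

Lemma cocycle_mul_closed rho rho' :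
  is_cocycle rho -> is_cocycle rho' -> is_cocycle (cocycle_mul rho rho').
Proof.
move=> r r'; have [rl r1 _ rb] := r; have [rl' r1' _ rb'] := r'.
have rM := coc_crossed_hom r; have rM' := coc_crossed_hom r'.
apply: crossed_hom_cocycle.
- exact: cocycle_mul_linear.
- exact: cocycle_mul_one.
- exact: cocycle_mul_crossed_hom.
- by apply: (eq_bij (bij_comp rb rb')) => b; rewrite psi_comp.
Qed.

Lemma psi_unit b : psi (@cocycle_unit k H B) b = b.
Proof.
rewrite -[RHS](coact_counit (DY_comodule (bc_DY B))).
by apply: eq_tlift => b0 b1; rewrite amulZr amul1r.
Qed.

Lemma cocycle_unit_linear : linear (@cocycle_unit k H B).
Proof. exact: conv1_linear. Qed.

Lemma cocycle_unitP : is_cocycle (@cocycle_unit k H B).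
Proof.
have ul := cocycle_unit_linear.
apply: crossed_hom_cocycle => //.
- by rewrite /cocycle_unit counit_one scale1r.
- move=> g; rewrite act_unit; apply/funext => h.
  rewrite -[in RHS]/(@conv1 k H B) conv1r; last first.
    exact: lin_scaler (conv1_linear (H := H) B).
  by rewrite /cocycle_unit counit_mul -scalerA.
- by exists id => b; rewrite psi_unit.
Qed.

Lemma cocycle_mulA rho1 rho2 rho3 :
  is_cocycle rho1 -> is_cocycle rho2 -> is_cocycle rho3 ->
  cocycle_mul rho1 (cocycle_mul rho2 rho3) =
  cocycle_mul (cocycle_mul rho1 rho2) rho3.
Proof.
move=> r1 r2 r3.
have [l1 _ _ _] := r1; have [l2 _ _ _] := r2; have [l3 _ _ _] := r3.
have M1 := coc_crossed_hom r1.
have p1 := psi_linear l1; have p2 := psi_linear l2.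
rewrite !cocycle_mulE.
rewrite (_ : (fun h => psi (conv _ _) _) =
   (fun h => psi rho1 (psi rho2 (rho3 h)))); last first.
  by apply/funext => h; rewrite -cocycle_mulE psi_comp.
rewrite -convA //; last 2 first.
- exact: lin_comp p1 l2.
- exact: lin_comp p1 (lin_comp p2 l3).
congr (conv rho1 _); apply/funext => h.
rewrite /conv (tlift_comp _ _ p1).
by apply: eq_tlift => x y; rewrite psi_mul.
Qed.

Lemma cocycle_mul1l rho : is_cocycle rho ->
  cocycle_mul (@cocycle_unit k H B) rho = rho.
Proof.
move=> [rl _ _ _]; rewrite cocycle_mulE -[RHS](conv1l rl).
by congr conv; apply/funext => h; rewrite psi_unit.
Qed.

Lemma psi_conv1 rho (h : H) : linear rho -> rho aone = aone ->
  psi rho (conv1 h) = conv1 h.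
Proof. by move=> rl r1; rewrite /conv1 (linZ _ _ (psi_linear rl)) psi_one. Qed.

Lemma cocycle_mul1r rho : is_cocycle rho ->
  cocycle_mul rho (@cocycle_unit k H B) = rho.
Proof.
move=> [rl r1 _ _]; rewrite cocycle_mulE -[RHS](conv1r rl).
by congr conv; apply/funext => h; rewrite -[cocycle_unit B h]/(conv1 h) psi_conv1.
Qed.

(** * Inverses of cocycles *)

(** The convolution inverse of a crossed map; for a group algebra it is
    [g |-> rho (g^-1) <| g]. *)
Definition cocycle_convinv rho (h : H) : B :=
  \sw_(x, y <- comul h) act (rho (antipode x)) y.

Lemma cocycle_convinv_linear rho : linear rho -> linear (cocycle_convinv rho).
Proof.
move=> rl; rewrite /cocycle_convinv; lin.
exact: lin_comp rl (@antipode_linear _ _).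
Qed.

(** The crossed law at [S(h_1) h_2]. *)
Lemma cocycle_convinvl rho : linear rho -> rho aone = aone ->
  crossed_hom rho -> conv (cocycle_convinv rho) rho = conv1.
Proof.
move=> rl r1 rM; apply/funext => h; rewrite /conv.
have Sl := @antipode_linear k H; have rSl := lin_comp rl Sl.
transitivity (\sw_(x, y <- comul h) \sw_(x1, x2 <- comul x)
   (act (rho (antipode x1)) x2 ** rho y)).
  by apply: eq_tlift => x y; rewrite tlift_mul.
rewrite (comul3 (F := fun x y z => act (rho (antipode x)) y ** rho z));
  try by move=> *; lins.
transitivity (\sw_(x, y <- comul h) rho (antipode x ** y)).
  apply: eq_tlift => x y.
  by rewrite (crossed_homE rM).
by rewrite -(tlift_comp _ _ rl) antipodel (linZ _ _ rl) r1.
Qed.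

(** The crossed law at [h_1 S(h_2)], acted upon by [h_3]. Since
    [comul_antipode] splits [S(h_2)], the element [S(h_3) h_4] appears acting on
    [rho h_1] and cancels, leaving [rho h_1 ** (rho (S h_2) <| h_3)]. *)
Lemma cocycle_convinvr rho : linear rho -> rho aone = aone ->
  crossed_hom rho -> conv rho (cocycle_convinv rho) = conv1.
Proof.
move=> rl r1 rM; apply/funext => h; rewrite /conv.
have Sl := @antipode_linear k H; have rSl := lin_comp rl Sl.
have <- : act (aone : B) h = conv1 h by rewrite (act_alg1 (bc_module_algebra B)).
have eps (g : H) : rho (counit g *: aone) = counit g *: aone.
  by rewrite (linZ _ _ rl) r1.
have hl : linear (act (aone : B)) by [].
rewrite -(comul_counitl_lin h hl).
transitivity (\sw_(x, y <- comul h) \sw_(x1, x2 <- comul x)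
    act (rho (x1 ** antipode x2)) y); last first.
  apply: eq_tlift => x y.
  rewrite -(linZ _ _ (act_linearl y)) -eps -antipoder.
  rewrite (tlift_comp _ _ rl).
  by rewrite (tlift_comp _ _ (act_linearl y)).
transitivity (\sw_(x, y <- comul h) \sw_(x1, x2 <- comul x)
   \sw_(u, v <- comul x2)
     (act (act (rho x1) (antipode v) ** rho (antipode u)) y));
  last first.
  apply: eq_tlift => x y; apply: eq_tlift => x1 x2.
  rewrite (crossed_homE rM) /conv comul_antipode.
  rewrite tlift_tpure; first by rewrite (tlift_comp _ _ (act_linearl y)).
    by split=> ?; lins.
  by lin.
transitivity (\sw_(x, y <- comul h) \sw_(x1, x2 <- comul x)
   \sw_(u, v <- comul x2) \sw_(a, b <- comul y)
   (act (rho x1) (antipode v ** a) ** act (rho (antipode u)) b)); last first.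
  apply: eq_tlift => x y; apply: eq_tlift => x1 x2; apply: eq_tlift => u v.
  rewrite (act_algM (bc_module_algebra B)); apply: eq_tlift => a b.
  by rewrite (act_mul (DY_module (bc_DY B))).
rewrite (comul3 (F := fun x y z => \sw_(u, v <- comul y) \sw_(a, b <- comul z)
   (act (rho x) (antipode v ** a) ** act (rho (antipode u)) b)));
  try by move=> *; lins.
apply: eq_tlift => x y.
rewrite (comul3 (F := fun u v z => \sw_(a, b <- comul z)
   (act (rho x) (antipode v ** a) ** act (rho (antipode u)) b)));
  try by move=> *; lins.
rewrite /cocycle_convinv mul_tlift; apply: eq_tlift => u w.
rewrite -(comul3 (F := fun v a b =>
   (act (rho x) (antipode v ** a) ** act (rho (antipode u)) b)));
  try by move=> *; lins.
have hl' : linear (fun z => rho x ** act (rho (antipode u)) z) by lin.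
rewrite -(comul_counitl_lin w hl'); apply: eq_tlift => s b.
rewrite -tlift_mul -(tlift_comp _ _ (act_linearr (rho x))) antipodel.
rewrite (linZ _ _ (act_linearr _)) (act_one (DY_module (bc_DY B))).
by rewrite amulZl.
Qed.

(** The law [rho^- (g h) = rho^- (h_1) ** (rho^- g <| h_2)], multiplied on the
    left by rho. Put [x g = rho * rho^- (g -)]. Evaluating [rho * rho^-] at
    [g h] shows that [(rho g_1 <| -) * x g_2] is the counit, so [x] is a
    convolution inverse in g of [g |-> (rho g <| -)]; as the action is
    multiplicative, [g |-> (rho^- g <| -)] is another one. *)
Lemma cocycle_convinv_mul rho : linear rho -> rho aone = aone ->
  crossed_hom rho -> forall g,
  conv rho (fun h => cocycle_convinv rho (g ** h)) =
  act (cocycle_convinv rho g).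
Proof.
move=> rl r1 rM; set r' := cocycle_convinv rho.
have rl' : linear r' := cocycle_convinv_linear rl.
have rr' : conv rho r' = conv1 := cocycle_convinvr rl r1 rM.
have r'r : conv r' rho = conv1 := cocycle_convinvl rl r1 rM.
pose x g := conv rho (fun h => r' (g ** h)).
have ul g : linear (fun h => r' (g ** h)) by lins.
have xl g : linear (x g) by exact: conv_linear.
have xl' h : linear (fun g => x g h) by rewrite /x /conv; lins.
have xE g h : \sw_(g1, g2 <- comul g) conv (act (rho g1)) (x g2) h
    = counit g *: conv1 h.
  rewrite /conv1 scalerA -counit_mul -[RHS]/(conv1 (g ** h)) -rr' /conv comul_mul.
  have fb : bilin (fun a b => rho a ** r' b) by split=> ?; lins.
  rewrite tlift_tlift //; try by lin.
  apply: eq_tlift => g1 g2; rewrite tlift_tpure //; try by lin.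
  by rewrite -/(conv (act (rho g1)) (x g2) h) /x convA // -rM.
move=> g; apply/funext => h; rewrite -/(x g).
transitivity (\sw_(g1, g2 <- comul g) \sw_(a, b <- comul g1)
   conv (act (r' a ** rho b)) (x g2) h).
  rewrite -[LHS](comul_counitl_lin g (xl' h)); apply: eq_tlift => g1 g2.
  transitivity (conv (act (conv r' rho g1)) (x g2) h).
    rewrite r'r act_unit -[in LHS](conv1l (xl g2)).
    rewrite /conv (tlift_comp _ _ (lin_scaler _ (@lin_id _ _))).
    by apply: eq_tlift => *; rewrite amulZl.
  rewrite /conv tlift_exchange; apply: eq_tlift => u v.
  by rewrite (tlift_comp _ _ (act_linearl u)) tlift_mul.
rewrite (comul3 (F := fun a b c => conv (act (r' a ** rho b)) (x c) h));
  try by move=> *; rewrite /conv; lins.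
have hl : linear (fun z => act (r' z) h) by lins.
rewrite -[RHS](comul_counitr_lin g hl); apply: eq_tlift => a c.
transitivity (conv (act (r' a)) (fun h => counit c *: conv1 h) h).
  transitivity (\sw_(b, d <- comul c)
      conv (act (r' a)) (conv (act (rho b)) (x d)) h).
    by apply: eq_tlift => b d; rewrite act_conv convA.
  rewrite /conv tlift_exchange; apply: eq_tlift => u v.
  by rewrite -mul_tlift -/(conv _ _ _) -xE.
rewrite -[in RHS](conv1r (act_linearr (r' a))).
rewrite /conv (tlift_comp _ _ (lin_scaler _ (@lin_id _ _))).
by apply: eq_tlift => *; rewrite amulZr.
Qed.

(** For [rho' = psi^-1 o rho^-] the product [rho . rho'] is [rho * rho^- = 1].
    Hence [psi o psi'] is the identity, so that psi' is [psi^-1]. The crossed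
    law for rho' is checked after applying psi, where it reads
    [rho^- (g -) = psi (rho' g <| -) * rho^-]; both sides agree after
    convolution by rho on the left, by [cocycle_convinv_mul] and [psi_act]. *)
Lemma cocycle_inv rho : is_cocycle rho -> exists2 rho', is_cocycle rho' &
  cocycle_mul rho rho' = @cocycle_unit k H B.
Proof.
move=> r; have [rl r1 _ [phi phiK Kphi]] := r.
have rM := coc_crossed_hom r.
have pl := psi_linear rl; have pM := psi_mul rl rM; have p1 := psi_one rl r1.
have phil : linear phi.
  by move=> c x y; apply: (can_inj phiK); rewrite pl !Kphi.
have phi1 : phi aone = aone by rewrite -p1 phiK.
pose r' := cocycle_convinv rho.
have rl' : linear r' := cocycle_convinv_linear rl.
have rr' : conv rho r' = conv1 := cocycle_convinvr rl r1 rM.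
have r'r : conv r' rho = conv1 := cocycle_convinvl rl r1 rM.
pose rho' h := phi (r' h).
have l' : linear rho' := lin_comp phil rl'.
have pr' h : psi rho (rho' h) = r' h by rewrite /rho' Kphi.
have mE : cocycle_mul rho rho' = @cocycle_unit k H B.
  by rewrite cocycle_mulE -[RHS]rr'; congr conv; apply/funext.
exists rho' => //.
have phi'K b : psi rho (psi rho' b) = b by rewrite -psi_comp // mE psi_unit.
have phi'E b : psi rho' b = phi b by rewrite -[RHS](congr1 phi (phi'K b)) phiK.
apply: crossed_hom_cocycle => //.
- rewrite /rho' (_ : r' aone = aone) //.
  have := congr1 (fun f => f aone) rr'; rewrite /conv comulE1; last first.
    by split=> ?; lins.
  by rewrite r1 amul1l /conv1 counit_one scale1r.
- move=> g.
  have pal b : linear (fun h => psi rho (act b h)) := lin_comp pl (act_linearr b).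
  have vl : linear (conv (fun h => psi rho (act (rho' g) h)) r').
    exact: conv_linear.
  have ul : linear (fun h => r' (g ** h)) by lins.
  (* Both maps become act (r' g) after convolution by rho, which is
     cancelled with r'. *)
  have vE : conv rho (conv (fun h => psi rho (act (rho' g) h)) r') = act (r' g).
    by rewrite convA // psi_act // pr' -convA // rr' conv1r.
  have uv : (fun h => r' (g ** h)) = conv (fun h => psi rho (act (rho' g) h)) r'.
    rewrite -(conv1l ul) -(conv1l vl) -r'r -!convA // vE.
    by rewrite cocycle_convinv_mul.
  apply/funext => h; apply: (can_inj phiK); rewrite pr'.
  rewrite -[r' _]/((fun h => r' (g ** h)) h) uv /conv (tlift_comp _ _ pl).
  by apply: eq_tlift => a b; rewrite pM pr'.
- by apply: (eq_bij (Bijective Kphi phiK)) => b; rewrite phi'E.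
Qed.

(** A monoid in which every element has a right inverse is a group. *)
Lemma cocycles_group : is_group (cocycles B).
Proof.
split.
- exact: cocycle_mul_closed.
- exact: cocycle_unitP.
- exact: cocycle_mulA.
- exact: cocycle_mul1l.
- exact: cocycle_mul1r.
move=> r rP; have [r' r'P e] := cocycle_inv rP; exists r'; split=> //.
have [r'' r''P e'] := cocycle_inv r'P.
suff <- : r'' = r by [].
have : cocycle_mul r (cocycle_mul r' r'') = cocycle_mul (cocycle_mul r r') r''.
  exact: cocycle_mulA.
by rewrite e e' cocycle_mul1l // cocycle_mul1r.
Qed.

End CocycleMonoid.

(** * Left and right bisections of a left bialgebroid *)

Section Bisections.
Variables (k : fieldType) (B : kAlgType k) (L : leftBialgebroid B).
Implicit Types (sigma eta : L -> B) (X Y : L).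

(** [sigma (t(b) X) = sigma (t(b) s(sigma X))], and the images of s and t
    commute. *)
Lemma rbis_tgt sigma : is_right_bisection sigma -> forall b X,
  sigma (tgt b ** X) = sigma X ** sigma (tgt b).
Proof. by move=> s b X; rewrite (rbis_mul_src s) -src_tgt (rbis_src s). Qed.

Lemma lbis_src sigma : is_left_bisection sigma -> forall b X,
  sigma (src b ** X) = sigma (src b) ** sigma X.
Proof. by move=> s b X; rewrite (lbis_mul_tgt s) src_tgt (lbis_tgt s). Qed.

(** The target half of the product axiom follows from the source half, applied to
    [Y = t(c)]: it gives [sigma (X t(c)) = sigma (X s(psi c))]. *)
Lemma right_bis_of sigma : linear sigma -> sigma aone = aone ->
  (forall b X, sigma (src b ** X) = b ** sigma X) ->
  is_alg_aut (fun b => sigma (tgt b)) ->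
  (forall X Y, sigma (X ** Y) = sigma (X ** src (sigma Y))) ->
  is_right_bisection sigma.
Proof.
move=> sl s1 ss sA sM; split=> // psiV psiK Kpsi X Y.
by rewrite [RHS]sM Kpsi.
Qed.

(** The mirror image of [right_bis_of]. *)
Lemma left_bis_of sigma : linear sigma -> sigma aone = aone ->
  (forall b X, sigma (tgt b ** X) = sigma X ** b) ->
  is_alg_aut (fun b => sigma (src b)) ->
  (forall X Y, sigma (X ** Y) = sigma (X ** tgt (sigma Y))) ->
  is_left_bisection sigma.
Proof.
move=> sl s1 ss sA sM; split=> // phiV phiK Kphi X Y.
by rewrite [RHS]sM Kphi.
Qed.

(** Bijectivity is a mere existence statement; this selects the inverse as a
    function. *)
Definition bij_inv (f : B -> B) (c : B) : B := xget 0 [set b | f b = c].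

Lemma bij_invK (f : B -> B) : bijective f -> cancel f (bij_inv f).
Proof.
move=> fb b; apply: (bij_inj fb).
exact: (xgetI (P := [set x | f x = f b]) 0 (erefl (f b))).
Qed.

Lemma bij_invKV (f : B -> B) : bijective f -> cancel (bij_inv f) f.
Proof. by move=> fb c; have [g _ Kg] := fb; rewrite -(Kg c) bij_invK. Qed.

Lemma alg_aut_inv (f : B -> B) : is_alg_aut f -> is_alg_aut (bij_inv f).
Proof.
move=> [fl fM f1 fb]; have fK := bij_invK fb; have Kf := bij_invKV fb.
split.
- by move=> c a b; apply: (bij_inj fb); rewrite fl !Kf.
- by move=> a b; apply: (bij_inj fb); rewrite fM !Kf.
- by rewrite -f1 fK.
- exact: Bijective Kf fK.
Qed.

Lemma eq_alg_aut (f g : B -> B) : f =1 g -> is_alg_aut g -> is_alg_aut f.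
Proof. by move=> /funext ->. Qed.

(** [psi^-1 o sigma] with [psi = sigma o t], and [phi^-1 o sigma] with
    [phi = sigma o s]. *)
Definition right_to_left sigma X : B :=
  bij_inv (fun b => sigma (tgt b)) (sigma X).
Definition left_to_right sigma X : B :=
  bij_inv (fun b => sigma (src b)) (sigma X).

(** Applying [psi^-1] to [sigma (t(b) X) = sigma X ** psi b] makes the result
    right B-linear along t, and its restriction along s is [psi^-1]. The axiom
    on products is the target half of the axiom for right bisections. *)
Lemma right_to_leftP sigma :
  is_right_bisection sigma -> is_left_bisection (right_to_left sigma).
Proof.
move=> s; have A := rbis_aut s; have [vl vM v1 _] := alg_aut_inv A.
have K := bij_invK (aut_bij A); have KV := bij_invKV (aut_bij A).
have srcE b : right_to_left sigma (src b) = bij_inv (fun b => sigma (tgt b)) b.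
  by rewrite /right_to_left -[src b]amul1r (rbis_src s) (rbis_one s) amul1r.
apply: left_bis_of => //.
- exact: (lin_comp vl (rbis_linear s)).
- by rewrite /right_to_left (rbis_one s) v1.
- by move=> b X; rewrite /right_to_left (rbis_tgt s) vM K.
- exact: (eq_alg_aut srcE (alg_aut_inv A)).
- by move=> X Y; rewrite /right_to_left -(rbis_mul_tgt s).
Qed.

Lemma left_to_rightP sigma :
  is_left_bisection sigma -> is_right_bisection (left_to_right sigma).
Proof.
move=> s; have A := lbis_aut s; have [vl vM v1 _] := alg_aut_inv A.
have K := bij_invK (aut_bij A); have KV := bij_invKV (aut_bij A).
have tgtE b : left_to_right sigma (tgt b) = bij_inv (fun b => sigma (src b)) b.
  by rewrite /left_to_right -[tgt b]amul1r (lbis_tgt s) (lbis_one s) amul1l.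
apply: right_bis_of => //.
- exact: (lin_comp vl (lbis_linear s)).
- by rewrite /left_to_right (lbis_one s) v1.
- by move=> b X; rewrite /left_to_right (lbis_src s) vM K.
- exact: (eq_alg_aut tgtE (alg_aut_inv A)).
- by move=> X Y; rewrite /left_to_right -(lbis_mul_src s).
Qed.

Lemma bij_inv_uniq (f g : B -> B) : bijective f -> cancel g f ->
  bij_inv f = g.
Proof.
by move=> fb gK; apply/funext => b; rewrite -{1}(gK b) bij_invK.
Qed.

Lemma right_to_leftK sigma :
  is_right_bisection sigma -> left_to_right (right_to_left sigma) = sigma.
Proof.
move=> s; apply/funext => X; rewrite /left_to_right.
have A := rbis_aut s; have K := bij_invK (aut_bij A).
rewrite (bij_inv_uniq (g := fun b => sigma (tgt b))).
- by rewrite /right_to_left (bij_invKV (aut_bij A)).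
- exact: aut_bij (lbis_aut (right_to_leftP s)).
move=> b; rewrite /right_to_left -[src _]amul1r (rbis_src s) (rbis_one s).
by rewrite amul1r K.
Qed.

Lemma left_to_rightK sigma :
  is_left_bisection sigma -> right_to_left (left_to_right sigma) = sigma.
Proof.
move=> s; apply/funext => X; rewrite /right_to_left.
have A := lbis_aut s; have K := bij_invK (aut_bij A).
rewrite (bij_inv_uniq (g := fun b => sigma (src b))).
- by rewrite /left_to_right (bij_invKV (aut_bij A)).
- exact: aut_bij (rbis_aut (left_to_rightP s)).
move=> b; rewrite /left_to_right -[tgt _]amul1r (lbis_tgt s) (lbis_one s).
by rewrite amul1l K.
Qed.

Lemma right_bis_mulE sigma eta : is_right_bisection sigma -> forall X,
  right_bis_mul sigma eta X =
  \sw_(X1, X2 <- bd_comul X) (sigma X1 ** sigma (tgt (eta X2))).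
Proof. by move=> s X; apply: eq_tlift => X1 X2; rewrite rbis_tgt. Qed.

Lemma left_bis_mulE sigma eta : is_left_bisection sigma -> forall X,
  left_bis_mul sigma eta X =
  \sw_(X1, X2 <- bd_comul X) (sigma (src (eta X1)) ** sigma X2).
Proof. by move=> s X; apply: eq_tlift => X1 X2; rewrite lbis_src. Qed.

Lemma bd_comul_tgt b : bd_comul (tgt b : L) = aone ⊗ tgt b.
Proof.
have -> : tgt b = src aone ** tgt b ** aone :> L.
  by rewrite src_one amul1l amul1r.
rewrite bd_comul_bimod bd_comul_one src_one amul1l amul1r.
rewrite tlift_pure ?amul1l ?amul1r //; first by lin.
move=> c X Y; rewrite !amul1l tpure_balanced.
by rewrite !amulA src_tgt.
Qed.

Lemma right_bis_mul_tgt sigma eta b :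
  is_right_bisection sigma -> is_right_bisection eta ->
  right_bis_mul sigma eta (tgt b) = sigma (tgt (eta (tgt b))).
Proof.
move=> s e; rewrite /right_bis_mul bd_comul_tgt tlift_pure ?amul1r //.
- have sl := rbis_linear s; have el := rbis_linear e.
  have tl := @tgt_linear _ _ L.
  by split=> Y; lins.
- by move=> c X Y; rewrite (rbis_src e) tgt_mul amulA.
Qed.

(** Apply the automorphism [psi_sigma o psi_eta] of the product to both sides:
    either way the value at X is [sigma X_1 ** psi_sigma (eta X_2)]. *)
Lemma right_to_left_mul sigma eta :
  is_right_bisection sigma -> is_right_bisection eta ->
  is_right_bisection (right_bis_mul sigma eta) ->
  right_to_left (right_bis_mul sigma eta) =
  left_bis_mul (right_to_left eta) (right_to_left sigma).
Proof.
move=> s e se; apply/funext => X.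
have sA := rbis_aut s; have eA := rbis_aut e; have seA := rbis_aut se.
apply: (bij_inj (aut_bij seA)).
rewrite /right_to_left (bij_invKV (aut_bij seA)) -/(right_to_left _).
rewrite right_bis_mul_tgt // right_bis_mulE // left_bis_mulE; last first.
  exact: right_to_leftP.
rewrite (tlift_comp _ _ (aut_linear eA)) (tlift_comp _ _ (aut_linear sA)).
apply: eq_tlift => X1 X2.
rewrite (aut_mul eA) (aut_mul sA) {2}/right_to_left (bij_invKV (aut_bij eA)).
congr (_ ** _).
rewrite /right_to_left (bij_invKV (aut_bij eA)).
rewrite -[src _]amul1r (rbis_src e) (rbis_one e) amul1r.
by rewrite (bij_invKV (aut_bij sA)).
Qed.

Lemma right_to_left_counit :
  is_right_bisection (@bd_counit k B L) ->
  right_to_left (@bd_counit k B L) = @bd_counit k B L.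
Proof.
move=> s; apply/funext => X; have A := rbis_aut s.
apply: (bij_inj (aut_bij A)); rewrite (bij_invKV (aut_bij A)).
rewrite -[tgt _]amul1r.
have := bd_counit_bimod aone (bd_counit X) (aone : L).
by rewrite src_one bd_counit_one !amul1l.
Qed.

End Bisections.

(** * Right bisections of the action Hopf algebroid are cocycles *)

Section ActionBisections.
Variables (k : fieldType) (H : hopfAlgebra k) (B : braidedCommAlgebra H).
Local Notation L := (actionHopfAlgebroid B).

(** The left B-linear extension of rho along [h |-> 1#h]. *)
Definition cocycle_bis (rho : H -> B) (X : L) : B :=
  \sw_(a, h <- (X : smash B)) (a ** rho h).

Lemma cocycle_bisE rho a h : linear rho ->
  cocycle_bis rho (a ⊗ h : smash B) = a ** rho h.
Proof. by move=> rl; rewrite /cocycle_bis tlift_pure //; lins. Qed.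

Lemma cocycle_bis_linear rho : linear rho -> linear (cocycle_bis rho).
Proof. by move=> rl; rewrite /cocycle_bis; lins. Qed.

(** The right side depends on [b#g] only through [b ** rho g], the value of the
    bisection there; this is what the product axiom asks for. *)
Lemma cocycle_bis_mulpure rho : linear rho -> crossed_hom rho ->
  forall (a b : B) (h g : H),
  cocycle_bis rho ((a ⊗ h : smash B) ** (b ⊗ g : smash B)) =
  a ** conv (act (b ** rho g)) rho h.
Proof.
move=> rl rM a b h g; rewrite smash_pureE.
rewrite (tlift_comp _ _ (cocycle_bis_linear rl)).
have bl := act_linearr b; have gl := act_linearr (rho g).
rewrite act_conv -convA // -rM mul_tlift; apply: eq_tlift => x y.
by rewrite cocycle_bisE // amulA.
Qed.

Lemma cocycle_bisP rho : is_cocycle rho -> is_right_bisection (cocycle_bis rho).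
Proof.
move=> r; have [rl r1 _ rb] := r; have rM := coc_crossed_hom r.
have sl := cocycle_bis_linear rl.
have ml (X : L) : linear (fun Y : L => X ** Y) := amul_linr X.
have mr (X : L) : linear (fun Y : L => Y ** X) := amul_linl X.
have srl := @src_linear _ _ L.
apply: right_bis_of => //.
- by rewrite -[aone in LHS]/(aone ⊗ aone : smash B) cocycle_bisE // r1 amul1l.
- move=> b; apply: smash_ext => [||a h].
  + exact: lin_comp sl (ml _).
  + exact: lin_mulr.
  by rewrite -[src b]/(smash_src b) smash_srcE !cocycle_bisE // amulA.
- split=> //.
  + exact: psi_linear.
  + exact: psi_mul.
  + exact: psi_one.
- move=> X Y; move: X; apply: smash_ext => [||a h].
  + exact: lin_comp sl (mr _).
  + exact: lin_comp sl (mr _).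
  move: Y; apply: smash_ext => [||b g].
  + exact: lin_comp sl (ml _).
  + by apply: (lin_comp sl); apply: (lin_comp (ml _)); apply: lin_comp srl sl.
  rewrite cocycle_bisE // -[src _]/((b ** rho g) ⊗ aone : smash B).
  by rewrite !cocycle_bis_mulpure // r1 amul1r.
Qed.

Definition bis_cocycle (sigma : L -> B) (h : H) : B :=
  sigma (aone ⊗ h : smash B).

Lemma bis_cocycleK (sigma : L -> B) : is_right_bisection sigma ->
  cocycle_bis (bis_cocycle sigma) = sigma.
Proof.
move=> s; have sl := rbis_linear s.
have rl : linear (bis_cocycle sigma) by rewrite /bis_cocycle; lins.
apply/funext; apply: smash_ext => [||a h]; [exact: cocycle_bis_linear|by []|].
rewrite cocycle_bisE // -(rbis_src s); congr sigma.
by rewrite -[src a]/(smash_src a) smash_srcE amul1r.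
Qed.

Lemma cocycle_bisK (rho : H -> B) : linear rho ->
  bis_cocycle (cocycle_bis rho) = rho.
Proof.
by move=> rl; apply/funext => h; rewrite /bis_cocycle cocycle_bisE // amul1l.
Qed.

(** The source half of the product axiom at [X = 1#h], [Y = 1#g] is the crossed law. *)
Lemma bis_cocycleP (sigma : L -> B) : is_right_bisection sigma ->
  is_cocycle (bis_cocycle sigma).
Proof.
move=> s; have sl := rbis_linear s.
have rl : linear (bis_cocycle sigma) by rewrite /bis_cocycle; lins.
have sE (a : B) h : sigma (a ⊗ h : smash B) = a ** bis_cocycle sigma h.
  by rewrite -{1}(bis_cocycleK s) cocycle_bisE.
apply: crossed_hom_cocycle => //.
- exact: rbis_one s.
- move=> g; apply/funext => h.
  have e : (aone ⊗ h : smash B) ** (aone ⊗ g : smash B) = aone ⊗ (g ** h).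
    rewrite smash_pureE.
    have hl : linear (fun z => aone ⊗ (g ** z) : smash B) by lin.
    rewrite -[RHS](comul_counitl_lin h hl); apply: eq_tlift => x y.
    by rewrite (act_alg1 (bc_module_algebra B)) amul1l tpureZl.
  have : sigma (aone ⊗ (g ** h) : smash B) =
      sigma ((aone ⊗ h : smash B) ** smash_src (bis_cocycle sigma g)).
    by rewrite -e; apply: rbis_mul_src s _ _.
  rewrite smash_mulsrcE (tlift_comp _ _ sl).
  rewrite sE amul1l => ->.
  by apply: eq_tlift => x y; rewrite sE amul1l.
- have [psiV K KV] := aut_bij (rbis_aut s).
  have e b : cocycle_psi (bis_cocycle sigma) b = sigma (tgt b).
    by rewrite -[in RHS](bis_cocycleK s).
  by apply: (eq_bij (Bijective K KV)) => b; rewrite e.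
Qed.

Lemma cocycle_bis_mul (rho rho' : H -> B) :
  is_cocycle rho -> is_cocycle rho' ->
  cocycle_bis (cocycle_mul rho rho') =
  right_bis_mul (cocycle_bis rho) (cocycle_bis rho').
Proof.
move=> r r'; have [rl _ _ _] := r; have [rl' _ _ _] := r'.
have s := cocycle_bisP r; have s' := cocycle_bisP r'.
have sl := rbis_linear s; have sl' := rbis_linear s'.
have ml := cocycle_mul_linear rl rl'.
have tl := @tgt_linear _ _ L.
have fb : bilin (fun X1 X2 : L =>
    cocycle_bis rho (tgt (cocycle_bis rho' X2) ** X1)).
  by split=> Y; lins.
have fB : balanced (fun b X => tgt b ** X) (fun b X => src b ** X)
    (fun X1 X2 : L => cocycle_bis rho (tgt (cocycle_bis rho' X2) ** X1)).
  by move=> c X Y; rewrite (rbis_src s') tgt_mul amulA.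
apply/funext; apply: smash_ext => [||a h].
- exact: cocycle_bis_linear.
- exact: (lin_comp (tlift_linear fb fB) (@bd_comul_linear _ _ L)).
rewrite cocycle_bisE // /right_bis_mul tensB_lift // mul_tlift.
apply: eq_tlift => x y; rewrite rbis_tgt // !cocycle_bisE // amul1l amulA.
by [].
Qed.

Lemma cocycle_bis_unit :
  cocycle_bis (@cocycle_unit k H B) = @bd_counit k B L.
Proof.
apply/funext => X; apply: eq_tlift => a h.
by rewrite amulZr amul1r.
Qed.

Lemma cocycle_bis_bij :
  set_bij (so_set (cocycles B)) (so_set (rightBisections L)) cocycle_bis.
Proof.
split.
- by move=> rho; apply: cocycle_bisP.
- move=> rho rho' /set_mem [rl _ _ _] /set_mem [rl' _ _ _] e.
  by rewrite -(cocycle_bisK rl) e cocycle_bisK.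
- move=> sigma s; exists (bis_cocycle sigma); first exact: bis_cocycleP.
  exact: bis_cocycleK.
Qed.

End ActionBisections.

Lemma right_to_left_bij (k : fieldType) (B : kAlgType k) (L : leftBialgebroid B) :
  set_bij (so_set (rightBisections L)) (so_set (opposite (leftBisections L)))
    (@right_to_left k B L).
Proof.
split.
- by move=> sigma; apply: right_to_leftP.
- move=> s s' /set_mem sP /set_mem sP' e.
  by rewrite -(right_to_leftK sP) e right_to_leftK.
- move=> s sP; exists (left_to_right s); first exact: left_to_rightP.
  exact: left_to_rightK.
Qed.

(** * Transport of group structures *)

Section Transport.
Variables (G K : setOp) (f : so_type G -> so_type K).
Hypotheses (gG : is_group G) (fbij : set_bij (so_set G) (so_set K) f).
Hypothesis fM : forall x y, so_set G x -> so_set G y ->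
  f (so_mul x y) = so_mul (f x) (f y).

(** The group G has to be the source: the set K is not known beforehand to be
    stable under its operation, and stability is read off from G. *)
Lemma is_group_transport : f (so_unit G) = so_unit K -> is_group K.
Proof.
move=> f1; have [Gm Gu GA G1l G1r GV] := gG; have [ff _ fs] := fbij.
split.
- move=> _ _ /fs[x Gx <-] /fs[y Gy <-].
  by rewrite -fM //; apply: ff; apply: Gm.
- by rewrite -f1; apply: ff.
- move=> _ _ _ /fs[x Gx <-] /fs[y Gy <-] /fs[z Gz <-].
  by rewrite -!fM ?GA //; apply: Gm.
- by move=> _ /fs[x Gx <-]; rewrite -f1 -fM // G1l.
- by move=> _ /fs[x Gx <-]; rewrite -f1 -fM // G1r.
- move=> _ /fs[x Gx <-]; have [y [Gy yx xy]] := GV x Gx.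
  by exists (f y); split; [exact: ff|rewrite -fM // yx|rewrite -fM // xy].
Qed.

Lemma group_iso_sym : group_iso K G.
Proof.
have [ff fi fs] := fbij.
have /choice[g gP] y : exists x, so_set K y -> so_set G x /\ f x = y.
  have [/fs[x Gx fx]|nKy] := pselect (so_set K y); first by exists x.
  by exists (so_unit G).
have gf x : so_set G x -> g (f x) = x.
  move=> Gx; have [Gg e] := gP _ (ff _ Gx).
  by apply: fi e; apply: mem_set.
exists g; split; last first.
  move=> _ _ /fs[x Gx <-] /fs[y Gy <-].
  by rewrite -fM // !gf //; apply: (group_mulP gG).
split.
- by move=> y /gP[].
- move=> y y' /set_mem /gP[_ e] /set_mem /gP[_ e'] gg.
  by rewrite -e gg.
- by move=> x Gx; exists (f x); [exact: ff|exact: gf].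
Qed.

End Transport.

Lemma is_group_opposite G : is_group (opposite G) -> is_group G.
Proof.
move=> [Gm Gu GA G1l G1r GV]; split=> //.
- by move=> x y Gx Gy; apply: Gm.
- by move=> x y z Gx Gy Gz; apply: esym (GA z y x Gz Gy Gx).
- by move=> x /GV[y [Gy yx xy]]; exists y.
Qed.

Theorem proposition5p3 (k : fieldType) (H : hopfAlgebra k)
    (antipode_bij : bijective (@antipode k H)) (B : braidedCommAlgebra H) :
  [/\ is_group (rightBisections (actionHopfAlgebroid B)),
      is_group (cocycles B) &
      is_group (leftBisections (actionHopfAlgebroid B))] /\
  [/\ group_iso (rightBisections (actionHopfAlgebroid B)) (cocycles B) &
      group_iso (cocycles B)
        (opposite (leftBisections (actionHopfAlgebroid B)))].
Proof.
pose L := actionHopfAlgebroid B.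
have Zg : is_group (cocycles B) := cocycles_group B.
have Fbij := cocycle_bis_bij B.
have Fmul (r r' : H -> B) : is_cocycle r -> is_cocycle r' ->
    cocycle_bis (cocycle_mul r r') = _ := @cocycle_bis_mul k H B r r'.
have Rg : is_group (rightBisections L).
  exact: (is_group_transport Zg Fbij Fmul (cocycle_bis_unit B)).
have Tbij := right_to_left_bij L.
have Tmul (s s' : L -> B) : is_right_bisection s -> is_right_bisection s' ->
    right_to_left (right_bis_mul s s') =
    left_bis_mul (right_to_left s') (right_to_left s).
  by move=> sP s'P; apply: right_to_left_mul => //; exact: (group_mulP Rg).
have T1 := right_to_left_counit (group_unitP Rg).
have Lg : is_group (opposite (leftBisections L)).
  exact: (is_group_transport Rg Tbij Tmul T1).
split; split=> //; first exact: is_group_opposite.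
- exact: (group_iso_sym Zg Fbij Fmul).
- exists (@right_to_left k B L \o @cocycle_bis k H B); split.
  + exact: set_bij_comp Fbij Tbij.
  + move=> r r' rP r'P /=; rewrite Fmul // Tmul //; exact: cocycle_bisP.
Qed.
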